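(* Let $N\ge 2$ and let $R$ be an associative unitary ring. The natural inclusion $j_{!}:\mathbf{K}_N(\mathrm{Prj}\text{-}R)\to \mathbf{K}_N(\mathrm{Flat}\text{-}R)$ has a right adjoint functor.
   Context: $\mathrm{Mod}\text{-}R$ is the category of all left $R$-modules; $\mathrm{Prj}\text{-}R$ and $\mathrm{Flat}\text{-}R$ are its full subcategories of projective and of flat modules. For an additive category $\mathcal{C}$, an $N$-complex is a sequence $\mathbf{X}=(X^i,d^i_{\mathbf X}:X^i\to X^{i+1})_{i\in\mathbb{Z}}$ in which the composite of any $N$ consecutive maps is $0$; morphisms are commuting families of maps. Write $d^i_{\mathbf{X},\{r\}}=d^{i+r-1}_{\mathbf X}\cdots d^i_{\mathbf X}$ and $d^i_{\mathbf{X},\{0\}}=1_{X^i}$. A morphism $f:\mathbf{X}\to\mathbf{Y}$ is null-homotopic if there are $s^i\in\operatorname{Hom}(X^i,Y^{i-N+1})$ with $f^i=\sum_{j=0}^{N-1} d_{\mathbf{Y},\{N-1-j\}}^{i-(N-1-j)}\,s^{i+j}\,d^{i}_{\mathbf{X},\{j\}}$ for all $i$. $\mathbf{K}_N(\mathcal{C})$ is the homotopy category of unbounded $N$-complexes over $\mathcal{C}$: objects are $N$-complexes, morphisms are morphisms of $N$-complexes modulo null-homotopic ones. *)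

(* Defs.v *)
From HB Require Import structures.
From mathcomp Require Import all_boot all_algebra.
From mathcomp Require Import generic_quotient ring_quotient.
From mathcomp Require Import boolp functions prodnormedzmodule.
From mathcomp Require Import freeg.

Set Implicit Arguments.
Unset Strict Implicit.
Unset Printing Implicit Defensive.

Import GRing.Theory.
Local Open Scope ring_scope.
Local Open Scope quotient_scope.

Record category := Category {
  obj :> Type;
  hom : obj -> obj -> Type;
  idm : forall x, hom x x;
  comp : forall x y z, hom y z -> hom x y -> hom x z;
  comp1m : forall x y (f : hom x y), comp (idm y) f = f;
  compm1 : forall x y (f : hom x y), comp f (idm x) = f;
  compmA : forall x y z t (h : hom z t) (g : hom y z) (f : hom x y),
    comp h (comp g f) = comp (comp h g) f
}.

Record functor (C D : category) := Functor {
  fobj :> C -> D;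
  fmap : forall x y, hom x y -> hom (fobj x) (fobj y);
  fmap1 : forall x, fmap (idm x) = idm (fobj x);
  fmapM : forall x y z (g : hom y z) (f : hom x y),
    fmap (comp g f) = comp (fmap g) (fmap f)
}.

Definition left_adjoint_to (C D : category) (F : functor C D)
    (G : functor D C) : Prop :=
  exists phi : forall (x : C) (y : D), hom (F x) y -> hom x (G y),
    [/\ forall x y, bijective (@phi x y),
        forall x x' y (f : hom x' x) (u : hom (F x) y),
          phi x' y (comp u (fmap F f)) = comp (phi x y u) f
      & forall x y y' (g : hom y y') (u : hom (F x) y),
          phi x y' (comp g u) = comp (fmap G g) (phi x y u)].

(* The category of N-complexes up to homotopy over an additive category
   involves only the abelian group structure of its Hom sets, not its finite
   direct sums. *)
Record preadditive := Preadditive {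
  pobj :> Type;
  phom : pobj -> pobj -> zmodType;
  pid : forall x, phom x x;
  pcomp : forall x y z, phom y z -> phom x y -> phom x z;
  pcomp1m : forall x y (f : phom x y), pcomp (pid y) f = f;
  pcompm1 : forall x y (f : phom x y), pcomp f (pid x) = f;
  pcompA : forall x y z t (h : phom z t) (g : phom y z) (f : phom x y),
    pcomp h (pcomp g f) = pcomp (pcomp h g) f;
  pcompDl : forall x y z (g g' : phom y z) (f : phom x y),
    pcomp (g + g') f = pcomp g f + pcomp g' f;
  pcompDr : forall x y z (g : phom y z) (f f' : phom x y),
    pcomp g (f + f') = pcomp g f + pcomp g f'
}.

Declare Scope cat_scope.
Delimit Scope cat_scope with cat.
Notation "g \oc f" := (pcomp g f)
  (at level 40, left associativity, format "g  \oc  f") : cat_scope.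
Local Open Scope cat_scope.

Definition precat (C : preadditive) : category :=
  Category (@pcomp1m C) (@pcompm1 C) (@pcompA C).

Record additive_functor (C D : preadditive) := AdditiveFunctor {
  afunctor :> functor (precat C) (precat D);
  amapD : forall (x y : C) (f g : phom x y),
    fmap afunctor (f + g : phom x y) =
      (fmap afunctor f : phom _ _) + (fmap afunctor g : phom _ _) :> phom _ _
}.

Section FullSubcategory.
Variables (C : preadditive) (P : C -> Prop).

Definition full_sub : preadditive :=
  @Preadditive {x : C | P x} (fun x y => phom (sval x) (sval y))
    (fun x => pid (sval x)) (fun x y z g f => g \oc f)
    (fun x y => @pcomp1m C (sval x) (sval y))
    (fun x y => @pcompm1 C (sval x) (sval y))
    (fun x y z t => @pcompA C (sval x) (sval y) (sval z) (sval t))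
    (fun x y z => @pcompDl C (sval x) (sval y) (sval z))
    (fun x y z => @pcompDr C (sval x) (sval y) (sval z)).

End FullSubcategory.

Section FullInclusion.
Variables (C : preadditive) (P Q : C -> Prop) (PQ : forall x, P x -> Q x).

Definition full_incl_functor :
    functor (precat (full_sub P)) (precat (full_sub Q)) :=
  @Functor (precat (full_sub P)) (precat (full_sub Q))
    (fun x => exist Q (sval x) (PQ (svalP x))) (fun x y f => f)
    (fun=> erefl) (fun _ _ _ _ _ => erefl).

Definition full_incl : additive_functor (full_sub P) (full_sub Q) :=
  @AdditiveFunctor (full_sub P) (full_sub Q) full_incl_functor
    (fun _ _ _ _ => erefl).

End FullInclusion.

Section PreadditiveTheory.
Variable C : preadditive.
Implicit Types x y z : C.

Lemma pcomp0m x y z (f : phom x y) : (0 : phom y z) \oc f = 0.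
Proof. by apply: (addrI (0 \oc f)); rewrite -pcompDl !addr0. Qed.

Lemma pcompm0 x y z (g : phom y z) : g \oc (0 : phom x y) = 0.
Proof. by apply: (addrI (g \oc 0)); rewrite -pcompDr !addr0. Qed.

Lemma pcompNl x y z (g : phom y z) (f : phom x y) : (- g) \oc f = - (g \oc f).
Proof. by apply: (addrI (g \oc f)); rewrite -pcompDl !subrr pcomp0m. Qed.

Lemma pcompNr x y z (g : phom y z) (f : phom x y) : g \oc (- f) = - (g \oc f).
Proof. by apply: (addrI (g \oc f)); rewrite -pcompDr !subrr pcompm0. Qed.

Lemma pcomp_suml (I : Type) (r : seq I) x y z (g : I -> phom y z)
    (f : phom x y) :
  (\sum_(i <- r) g i) \oc f = \sum_(i <- r) (g i \oc f).
Proof.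
by apply: (big_morph (fun g => g \oc f)) => [g1 g2|]; rewrite ?pcompDl ?pcomp0m.
Qed.

Lemma pcomp_sumr (I : Type) (r : seq I) x y z (g : phom y z)
    (f : I -> phom x y) :
  g \oc (\sum_(i <- r) f i) = \sum_(i <- r) (g \oc f i).
Proof.
by apply: (big_morph (fun f => g \oc f)) => [f1 f2|]; rewrite ?pcompDr ?pcompm0.
Qed.

End PreadditiveTheory.

(* The identity of [X i], seen as a morphism [X i -> X j] when [i = j]: the
   integer indices below agree provably but not by computation. *)
Definition castm (C : preadditive) (X : int -> C) (i j : int) (e : i = j) :
    phom (X i) (X j) :=
  match e in _ = k return phom (X i) (X k) with erefl => pid (X i) end.
Arguments castm {C} X {i j} e.

Lemma idx0 (i : int) : i = i + 0%:Z.
Proof. by rewrite addr0. Qed.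

Lemma idxS (i : int) (r : nat) : i + r%:Z + 1 = i + r.+1%:Z.
Proof. by rewrite -addrA intS [1 + r%:Z]addrC. Qed.

(* [diter d r i] is d^i_{r} = d^{i+r-1} ... d^{i+1} d^i. *)
Fixpoint diter (C : preadditive) (X : int -> C)
    (d : forall i : int, phom (X i) (X (i + 1))) (r : nat) (i : int) :
    phom (X i) (X (i + r%:Z)) :=
  match r with
  | 0%N => castm X (idx0 i)
  | r'.+1 => castm X (idxS i r') \oc (d (i + r'%:Z) \oc diter d r' i)
  end.

Record Ncomplex (N : nat) (C : preadditive) := NComplex {
  cx :> int -> C;
  diff : forall i : int, phom (cx i) (cx (i + 1));
  diffN0 : forall i : int, diter diff N i = 0
}.
Arguments diff {N C} X i : rename.

Section ChainMaps.
Variables (N : nat) (C : preadditive).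
Implicit Types (X Y Z : Ncomplex N C) (i : int).

Record chain_map X Y := ChainMap {
  cmap :> forall i : int, phom (X i) (Y i);
  cmapP : forall i : int, cmap (i + 1) \oc diff X i = diff Y i \oc cmap i
}.

Lemma chain_mapP X Y (f g : chain_map X Y) : (forall i : int, f i = g i) -> f = g.
Proof.
case: f g => [f fP] [g gP] /= fg.
have {}fg : f = g by apply/functional_extensionality_dep.
by subst g; congr ChainMap; apply: Prop_irrelevance.
Qed.

Program Definition chain_id X := @ChainMap X X (fun i : int => pid (X i)) _.
Next Obligation. by move=> X i /=; rewrite pcomp1m pcompm1. Qed.

Program Definition chain_comp X Y Z (g : chain_map Y Z) (f : chain_map X Y) :=
  @ChainMap X Z (fun i : int => g i \oc f i) _.
Next Obligation.
by move=> X Y Z g f i /=; rewrite -pcompA cmapP pcompA cmapP -pcompA.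
Qed.

Lemma htpy_idx1 (i : int) (j : 'I_N) :
  i + j%:Z - N%:Z + 1 = i - (N.-1 - j)%N%:Z.
Proof.
case: N j => [[]//|n] j /=.
have jn : (j <= n)%N by rewrite -ltnS.
by rewrite -(subzn jn) intS opprD [- 1 - _]addrC addrA addrNK opprB addrA.
Qed.

Lemma htpy_idx2 (i : int) (k : nat) : i - k%:Z + k%:Z = i.
Proof. by rewrite subrK. Qed.

(* \sum_j d_{Y,{N-1-j}}^{i-(N-1-j)} s^{i+j} d_{X,{j}}^i, where s^{i+j} lands in
   Y^{i+j-N+1} = Y^{i-(N-1-j)}. *)
Definition homotopy_sum X Y (s : forall i : int, phom (X i) (Y (i - N%:Z + 1)))
    (i : int) : phom (X i) (Y i) :=
  \sum_(j < N)
    castm Y (htpy_idx2 i (N.-1 - j)) \oc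
    diter (diff Y) (N.-1 - j) (i - (N.-1 - j)%N%:Z) \oc
    castm Y (htpy_idx1 i j) \oc s (i + j%:Z) \oc diter (diff X) j i.

Definition null_homotopic X Y (f : forall i : int, phom (X i) (Y i)) : Prop :=
  exists s : forall i : int, phom (X i) (Y (i - N%:Z + 1)),
    forall i : int, f i = homotopy_sum s i.

Definition homotopic X Y (f g : chain_map X Y) : bool :=
  `[< null_homotopic (fun i : int => f i - g i) >].

Lemma null_homotopicD X Y (f g : forall i : int, phom (X i) (Y i)) :
  null_homotopic f -> null_homotopic g ->
  null_homotopic (fun i : int => f i + g i).
Proof.
move=> [s sP] [t tP]; exists (fun i : int => s i + t i) => i.
rewrite sP tP -big_split; apply: eq_bigr => j _ /=.
by rewrite pcompDr pcompDl.
Qed.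

Lemma null_homotopicN X Y (f : forall i : int, phom (X i) (Y i)) :
  null_homotopic f -> null_homotopic (fun i : int => - f i).
Proof.
move=> [s sP]; exists (fun i : int => - s i) => i.
rewrite sP -sumrN; apply: eq_bigr => j _ /=.
by rewrite pcompNr pcompNl.
Qed.

Lemma null_homotopic0 X Y : @null_homotopic X Y (fun=> 0).
Proof.
exists (fun=> 0) => i; rewrite /homotopy_sum big1 // => j _.
by rewrite pcompm0 pcomp0m.
Qed.

Lemma eq_null_homotopic X Y (f g : forall i : int, phom (X i) (Y i)) :
  (forall i : int, f i = g i) -> null_homotopic f -> null_homotopic g.
Proof. by move=> fg [s sP]; exists s => i; rewrite -fg. Qed.

Lemma castm_nat (X Y : int -> C) (f : forall i : int, phom (X i) (Y i))
    (i j : int) (e : i = j) :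
  f j \oc castm X e = castm Y e \oc f i.
Proof. by case: j / e => /=; rewrite pcompm1 pcomp1m. Qed.

Lemma diter_nat X Y (f : chain_map X Y) r i :
  f (i + r%:Z) \oc diter (diff X) r i = diter (diff Y) r i \oc f i.
Proof.
elim: r => [|r IHr] /=; first exact: castm_nat.
by rewrite pcompA castm_nat -!pcompA; congr (_ \oc _);
   rewrite pcompA cmapP -!pcompA IHr.
Qed.

Lemma null_homotopic_compl X Y Z (g : chain_map Y Z)
    (f : forall i : int, phom (X i) (Y i)) :
  null_homotopic f -> null_homotopic (fun i : int => g i \oc f i).
Proof.
move=> [s sP]; exists (fun i : int => g _ \oc s i) => i.
rewrite sP pcomp_sumr; apply: eq_bigr => j _.
by rewrite !pcompA castm_nat -!pcompA; congr (_ \oc _);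
   rewrite !pcompA diter_nat -!pcompA; congr (_ \oc _);
   rewrite !pcompA castm_nat.
Qed.

Lemma null_homotopic_compr X Y Z (g : forall i : int, phom (Y i) (Z i))
    (f : chain_map X Y) :
  null_homotopic g -> null_homotopic (fun i : int => g i \oc f i).
Proof.
move=> [s sP]; exists (fun i : int => s i \oc f i) => i.
rewrite sP pcomp_suml; apply: eq_bigr => j _.
by rewrite -!pcompA diter_nat.
Qed.

Lemma homotopic_refl X Y : reflexive (@homotopic X Y).
Proof.
move=> f; apply/asboolP; apply: eq_null_homotopic (null_homotopic0 X Y) => i.
by rewrite subrr.
Qed.

Lemma homotopic_sym X Y : symmetric (@homotopic X Y).
Proof.
by move=> f g; apply/asboolP/asboolP => /null_homotopicN;
   apply: eq_null_homotopic => i; rewrite opprB.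
Qed.

Lemma homotopic_trans X Y : transitive (@homotopic X Y).
Proof.
move=> g f h /asboolP fg /asboolP gh; apply/asboolP.
by apply: eq_null_homotopic (null_homotopicD fg gh) => i; rewrite subrKA.
Qed.

HB.instance Definition _ X Y := gen_eqMixin (chain_map X Y).
HB.instance Definition _ X Y := gen_choiceMixin (chain_map X Y).

Canonical homotopic_equiv X Y :=
  EquivRel (@homotopic X Y) (@homotopic_refl X Y) (@homotopic_sym X Y)
    (@homotopic_trans X Y).

Definition htpy_hom X Y := {eq_quot @homotopic X Y}.
Definition htpy_class X Y (f : chain_map X Y) : htpy_hom X Y := \pi f.

Lemma htpy_classP X Y (f g : chain_map X Y) :
  htpy_class f = htpy_class g <-> null_homotopic (fun i : int => f i - g i).
Proof.
split=> [/eqmodP /asboolP //|fg].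
by apply/eqmodP/asboolP.
Qed.

Lemma htpy_reprP X Y (f : chain_map X Y) :
  null_homotopic (fun i : int => repr (htpy_class f) i - f i).
Proof. by apply/htpy_classP; rewrite /htpy_class reprK. Qed.

Lemma htpy_reprK X Y (q : htpy_hom X Y) : htpy_class (repr q) = q.
Proof. exact: reprK. Qed.

Definition htpy_comp X Y Z (g : htpy_hom Y Z) (f : htpy_hom X Y) :=
  htpy_class (chain_comp (repr g) (repr f)).

Lemma htpy_compE X Y Z (g : chain_map Y Z) (f : chain_map X Y) :
  htpy_comp (htpy_class g) (htpy_class f) = htpy_class (chain_comp g f).
Proof.
apply/htpy_classP.
have := null_homotopicD
  (null_homotopic_compr (repr (htpy_class f)) (htpy_reprP g))
  (null_homotopic_compl g (htpy_reprP f)).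
apply: eq_null_homotopic => i /=.
by rewrite pcompDl pcompDr pcompNl pcompNr addrA addrNK.
Qed.

Lemma htpy_comp1m X Y (f : htpy_hom X Y) :
  htpy_comp (htpy_class (chain_id Y)) f = f.
Proof.
rewrite -[f]htpy_reprK htpy_compE; congr htpy_class.
by apply: chain_mapP => i; apply: pcomp1m.
Qed.

Lemma htpy_compm1 X Y (f : htpy_hom X Y) :
  htpy_comp f (htpy_class (chain_id X)) = f.
Proof.
rewrite -[f]htpy_reprK htpy_compE; congr htpy_class.
by apply: chain_mapP => i; apply: pcompm1.
Qed.

Lemma htpy_compA X Y Z T (h : htpy_hom Z T) (g : htpy_hom Y Z)
    (f : htpy_hom X Y) :
  htpy_comp h (htpy_comp g f) = htpy_comp (htpy_comp h g) f.
Proof.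
rewrite -[h]htpy_reprK -[g]htpy_reprK -[f]htpy_reprK !htpy_compE.
by congr htpy_class; apply: chain_mapP => i; apply: pcompA.
Qed.

Definition KN : category :=
  Category htpy_comp1m htpy_compm1 htpy_compA.

End ChainMaps.

Section InducedFunctor.
Variables (N : nat) (C D : preadditive) (F : additive_functor C D).
Implicit Types (X Y Z : Ncomplex N C) (i : int).

Definition amap (x y : C) (f : phom x y) : phom (F x : D) (F y : D) := fmap F f.

Lemma amapM (x y z : C) (g : phom y z) (f : phom x y) :
  amap (g \oc f) = amap g \oc amap f.
Proof. exact: (@fmapM _ _ F). Qed.

Lemma amap1 (x : C) : amap (pid x) = pid (F x : D).
Proof. exact: (@fmap1 _ _ F). Qed.

Lemma amap_add (x y : C) (f g : phom x y) : amap (f + g) = amap f + amap g.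
Proof. exact: amapD. Qed.

Lemma amap0 (x y : C) : amap (0 : phom x y) = 0.
Proof. by apply: (addrI (amap 0)); rewrite -amap_add !addr0. Qed.

Lemma amapB (x y : C) (f g : phom x y) : amap (f - g) = amap f - amap g.
Proof. by apply: (addIr (amap g)); rewrite -amap_add !subrK. Qed.

Lemma amap_castm (X : int -> C) (i j : int) (e : i = j) :
  amap (castm X e) = castm (fun k : int => F (X k) : D) e.
Proof. by case: j / e; apply: amap1. Qed.

Lemma amap_diter (X : int -> C) (d : forall i : int, phom (X i) (X (i + 1))) r i :
  amap (diter d r i) =
  @diter D (fun k : int => F (X k)) (fun k : int => amap (d k)) r i.
Proof.
elim: r => [|r IHr] /=; first exact: amap_castm.
by rewrite !amapM amap_castm IHr.
Qed.

Program Definition KN_obj X : Ncomplex N D :=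
  @NComplex N D (fun i : int => F (X i)) (fun i : int => amap (diff X i)) _.
Next Obligation. by move=> X i; rewrite -amap_diter diffN0 amap0. Qed.

Program Definition chain_image X Y (f : chain_map X Y) :=
  @ChainMap N D (KN_obj X) (KN_obj Y) (fun i : int => amap (f i)) _.
Next Obligation. by move=> X Y f i /=; rewrite -!amapM cmapP. Qed.

Lemma null_homotopic_image X Y (f : forall i : int, phom (X i) (Y i)) :
  null_homotopic f ->
  @null_homotopic N D (KN_obj X) (KN_obj Y) (fun i : int => amap (f i)).
Proof.
move=> [s sP]; exists (fun i : int => amap (s i)) => i.
rewrite sP (big_morph _ (@amap_add _ _) (@amap0 _ _)).
by apply: eq_bigr => j _; rewrite !amapM !amap_castm !amap_diter.
Qed.

Definition KN_map X Y (q : htpy_hom X Y) : htpy_hom (KN_obj X) (KN_obj Y) :=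
  htpy_class (chain_image (repr q)).

Lemma KN_mapE X Y (f : chain_map X Y) :
  KN_map (htpy_class f) = htpy_class (chain_image f).
Proof.
apply/htpy_classP; have /null_homotopic_image := htpy_reprP f.
by apply: eq_null_homotopic => i /=; rewrite amapB.
Qed.

Lemma KN_map1 X :
  KN_map (htpy_class (chain_id X)) = htpy_class (chain_id (KN_obj X)).
Proof.
by rewrite KN_mapE; congr htpy_class; apply: chain_mapP => i; apply: amap1.
Qed.

Lemma KN_mapM X Y Z (g : htpy_hom Y Z) (f : htpy_hom X Y) :
  KN_map (htpy_comp g f) = htpy_comp (KN_map g) (KN_map f).
Proof.
rewrite -[g]htpy_reprK -[f]htpy_reprK htpy_compE !KN_mapE htpy_compE.
by congr htpy_class; apply: chain_mapP => i; apply: amapM.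
Qed.

Definition KN_functor : functor (KN N C) (KN N D) :=
  @Functor (KN N C) (KN N D) KN_obj KN_map KN_map1 KN_mapM.

End InducedFunctor.

Section LinearZmodule.
Variables (R : pzRingType) (M P : lmodType R).
Implicit Types f g h : {linear M -> P}.

Lemma linearP_eq f g : f =1 g -> f = g.
Proof.
case: f g => [f [[fD] [fZ]]] [g [[gD] [gZ]]] /= /funext fg; subst g.
by rewrite (Prop_irrelevance fD gD) (Prop_irrelevance fZ gZ).
Qed.

Definition linear_zero : {linear M -> P} := \0.
Definition linear_opp f : {linear M -> P} := \- f.
Definition linear_add f g : {linear M -> P} := f \+ g.

Lemma linear_addA : associative linear_add.
Proof. by move=> f g h; apply: linearP_eq => x /=; apply: addrA. Qed.

Lemma linear_addC : commutative linear_add.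
Proof. by move=> f g; apply: linearP_eq => x /=; apply: addrC. Qed.

Lemma linear_add0 : left_id linear_zero linear_add.
Proof. by move=> f; apply: linearP_eq => x /=; apply: add0r. Qed.

Lemma linear_addN : left_inverse linear_zero linear_opp linear_add.
Proof. by move=> f; apply: linearP_eq => x /=; apply: addNr. Qed.

HB.instance Definition _ := GRing.isZmodule.Build {linear M -> P}
  linear_addA linear_addC linear_add0 linear_addN.

End LinearZmodule.

Section ModuleCategory.
Variable R : pzRingType.

Definition lin_id (M : lmodType R) : {linear M -> M} := idfun.

Definition lin_comp (M P Q : lmodType R) (g : {linear P -> Q})
  (f : {linear M -> P}) : {linear M -> Q} := g \o f.

Lemma lin_comp1m (M P : lmodType R) (f : {linear M -> P}) :
  lin_comp (lin_id P) f = f.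
Proof. exact: linearP_eq. Qed.

Lemma lin_compm1 (M P : lmodType R) (f : {linear M -> P}) :
  lin_comp f (lin_id M) = f.
Proof. exact: linearP_eq. Qed.

Lemma lin_compA (M P Q S : lmodType R) (h : {linear Q -> S})
    (g : {linear P -> Q}) (f : {linear M -> P}) :
  lin_comp h (lin_comp g f) = lin_comp (lin_comp h g) f.
Proof. exact: linearP_eq. Qed.

Lemma lin_compDl (M P Q : lmodType R) (g g' : {linear P -> Q})
    (f : {linear M -> P}) :
  lin_comp (g + g') f = lin_comp g f + lin_comp g' f.
Proof. exact: linearP_eq. Qed.

Lemma lin_compDr (M P Q : lmodType R) (g : {linear P -> Q})
    (f f' : {linear M -> P}) :
  lin_comp g (f + f') = lin_comp g f + lin_comp g f'.
Proof. by apply: linearP_eq => x /=; rewrite -raddfD. Qed.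

(* [lmodType R] is the type of left R-modules. *)
Definition Mod : preadditive :=
  @Preadditive (lmodType R) (fun M P => {linear M -> P} : zmodType)
    lin_id lin_comp lin_comp1m lin_compm1 lin_compA lin_compDl lin_compDr.

End ModuleCategory.

Definition surjective (A B : Type) (f : A -> B) : Prop :=
  forall b, exists a, f a = b.

Definition projective (R : pzRingType) (M : lmodType R) : Prop :=
  forall (A B : lmodType R) (g : {linear A -> B}) (f : {linear M -> B}),
    surjective g -> exists h : {linear M -> A}, forall x, g (h x) = f x.

Section Tensor.
Variables (R : pzRingType) (A : lmodType R^c) (M : lmodType R).

Local Notation free := {freeg (A * M)%type / int}.

Inductive tensor_rel : free -> Prop :=
| TensorRel0 : tensor_rel 0
| TensorRelB u v : tensor_rel u -> tensor_rel v -> tensor_rel (u - v)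
| TensorRelDl a a' m :
    tensor_rel (<< (a + a', m) >> - << (a, m) >> - << (a', m) >>)
| TensorRelDr a m m' :
    tensor_rel (<< (a, m + m') >> - << (a, m) >> - << (a, m') >>)
| TensorRelZ (r : R) a m :
    (* [(r : R^c) *: a] is the right action [a r] *)
    tensor_rel (<< ((r : R^c) *: a, m) >> - << (a, r *: m) >>).

Definition tensor_relb : {pred free} := fun u => `[< tensor_rel u >].

Lemma tensor_relb_closed : zmod_closed tensor_relb.
Proof.
split=> [|u v /asboolP ru /asboolP rv]; apply/asboolP.
- exact: TensorRel0.
- exact: TensorRelB.
Qed.

HB.instance Definition _ :=
  GRing.isZmodClosed.Build free tensor_relb tensor_relb_closed.

(* A \otimes_R M: the free abelian group on A * M modulo biadditivity and
   a r \otimes m = a \otimes r m; [tensor_lift_tens] and [tensor_ind] give its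
   universal property. *)
Definition tensor : zmodType := Quotient.quot tensor_relb.

Definition tens (a : A) (m : M) : tensor := \pi_tensor << (a, m) >>.

Lemma tensDl a a' m : tens (a + a') m = tens a m + tens a' m.
Proof.
apply/eqP; rewrite -subr_eq0 opprD addrA -!raddfB /= -(raddf0 (\pi_tensor)).
rewrite -Quotient.idealrBE subr0; apply/asboolP; exact: TensorRelDl.
Qed.

Lemma tensDr a m m' : tens a (m + m') = tens a m + tens a m'.
Proof.
apply/eqP; rewrite -subr_eq0 opprD addrA -!raddfB /= -(raddf0 (\pi_tensor)).
rewrite -Quotient.idealrBE subr0; apply/asboolP; exact: TensorRelDr.
Qed.

Lemma tensZ (r : R) a m : tens ((r : R^c) *: a) m = tens a (r *: m).
Proof.
apply/eqP; rewrite -subr_eq0 -!raddfB /= -(raddf0 (\pi_tensor)).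
rewrite -Quotient.idealrBE subr0; apply/asboolP; exact: TensorRelZ.
Qed.

Lemma tens0l m : tens 0 m = 0.
Proof. by apply: (addrI (tens 0 m)); rewrite -tensDl !addr0. Qed.

Lemma tens0r a : tens a 0 = 0.
Proof. by apply: (addrI (tens a 0)); rewrite -tensDr !addr0. Qed.

Lemma tensor_ind (P : tensor -> Prop) :
  (forall a m, P (tens a m)) -> P 0 ->
  (forall u v, P u -> P v -> P (u - v)) -> forall z, P z.
Proof.
move=> Ptens P0 PB z; rewrite -[z]reprK; move: (repr z) => {z} u.
have PD x y : P x -> P y -> P (x + y).
  by move=> Px Py; rewrite -[y]opprK -[- y]sub0r; do 2?apply: (PB) => //.
rewrite -[u]freeg_sumE raddf_sum; apply: big_ind => // -[a m] _ /=.
have Pn (n : nat) : P (tens a m *+ n).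
  by elim: n => [|n IHn]; rewrite ?mulr0n // mulrS; apply: PD.
have -> (k : int) : \pi_tensor << k *g (a, m) >> = tens a m *~ k.
  by rewrite /tens -raddfMz freegU_mulz intz.
by case: (coeff _ _) => n; rewrite ?NegzE ?mulrNz -pmulrn // -sub0r; apply: PB.
Qed.

Definition balanced (V : zmodType) (b : A -> M -> V) : Prop :=
  [/\ forall a a' m, b (a + a') m = b a m + b a' m,
      forall a m m', b a (m + m') = b a m + b a m'
    & forall (r : R) a m, b ((r : R^c) *: a) m = b a (r *: m)].

Definition tensor_lift (V : zmodType) (b : A -> M -> V) (z : tensor) : V :=
  fglift (fun am => b am.1 am.2 : zmodule V) (repr z).

Section Lift.
Variables (V : zmodType) (b : A -> M -> V).
Hypothesis bb : balanced b.

Local Notation bl := (fglift (fun am => b am.1 am.2 : zmodule V)).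

Lemma bl1 a m : bl << (a, m) >> = b a m.
Proof. by rewrite liftU scale1r. Qed.

Lemma blB u v : bl (u - v) = bl u - bl v.
Proof. exact: lift_is_additive. Qed.

Lemma bl_rel u : tensor_rel u -> bl u = 0.
Proof.
case: bb => bDl bDr bZ.
have b0 : bl 0 = 0 by rewrite -(subrr 0) blB subrr.
elim=> [|{}u v _ u0 _ v0|a a' m|a m m'|r a m] //; rewrite !blB ?u0 ?v0 ?subr0 //.
- by rewrite !bl1 bDl -addrA -opprD; apply: subrr.
- by rewrite !bl1 bDr -addrA -opprD; apply: subrr.
- by rewrite !bl1 bZ; apply: subrr.
Qed.

Lemma tensor_liftE u : tensor_lift b (\pi_tensor u) = bl u.
Proof.
apply/eqP; rewrite -subr_eq0 -blB; apply/eqP/bl_rel/asboolP.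
by rewrite -[`[< _ >]]/(_ \in tensor_relb) Quotient.idealrBE reprK.
Qed.

Lemma tensor_lift_tens a m : tensor_lift b (tens a m) = b a m.
Proof. by rewrite tensor_liftE bl1. Qed.

Lemma tensor_liftB : {morph tensor_lift b : u v / u - v}.
Proof.
move=> u v; rewrite -[u]reprK -[v]reprK -raddfB.
by rewrite !tensor_liftE blB.
Qed.

Lemma tensor_lift0 : tensor_lift b 0 = 0.
Proof. by rewrite -(subrr 0) tensor_liftB subrr. Qed.

End Lift.

End Tensor.

Section Flat.
Variables (R : pzRingType) (M : lmodType R).

Definition tensor_map (A B : lmodType R^c) (f : {linear A -> B}) :
    tensor A M -> tensor B M :=
  tensor_lift (fun a m => tens (f a) m).

(* As - \otimes_R M is always right exact, it is exact if and only if it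
   preserves injections. *)
Definition flat : Prop :=
  forall (A B : lmodType R^c) (f : {linear A -> B}),
    injective f -> injective (tensor_map f).

Lemma tensor_map_balanced (A B : lmodType R^c) (f : {linear A -> B}) :
  balanced (fun a (m : M) => tens (f a) m).
Proof.
split=> [a a' m|a m m'|r a m].
- by rewrite raddfD tensDl.
- by rewrite tensDr.
- by rewrite linearZ tensZ.
Qed.

Lemma tensor_map_tens (A B : lmodType R^c) (f : {linear A -> B}) a m :
  tensor_map f (tens a m) = tens (f a) m.
Proof. by rewrite /tensor_map (tensor_lift_tens (tensor_map_balanced f)). Qed.

End Flat.
Arguments tensor_map {R} M {A B} f z.

Section FreeModule.
Variables (R : pzRingType) (P : lmodType R).

Definition finsupp : {pred P -> R^o} :=
  fun f => `[< exists s : seq P, forall x, x \notin s -> f x = 0 >].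

Lemma finsupp_closed : submod_closed finsupp.
Proof.
split=> [|r f g /asboolP[s sf] /asboolP[t tg]]; apply/asboolP.
  by exists [::].
exists (s ++ t) => x; rewrite mem_cat negb_or => /andP[xs xt].
by rewrite -[LHS]/(r *: f x + g x) sf // tg // scaler0 addr0.
Qed.

HB.instance Definition _ :=
  GRing.isSubmodClosed.Build R (P -> R^o) finsupp finsupp_closed.

Record free_mod := FreeMod { free_fun :> P -> R^o; _ : free_fun \in finsupp }.

HB.instance Definition _ := [isSub for free_fun].
HB.instance Definition _ := [Choice of free_mod by <:].
HB.instance Definition _ := [SubChoice_isSubLmodule of free_mod by <:].

Lemma free_supp_ex (f : free_mod) :
  exists s : seq P, forall x, x \notin s -> f x = 0.
Proof. by case: f => f fP; apply/asboolP. Qed.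

Definition free_supp (f : free_mod) : seq P := projT1 (cid (free_supp_ex f)).

Lemma free_suppP (f : free_mod) x : x \notin free_supp f -> f x = 0.
Proof. by rewrite /free_supp; case: cid => s /= sP; apply: sP. Qed.

Definition free_eval (f : free_mod) : P :=
  \sum_(x <- undup (free_supp f)) (f x : R) *: (x : P).

Lemma free_evalE (f : free_mod) (s : seq P) : uniq s ->
  {subset free_supp f <= s} -> free_eval f = \sum_(x <- s) (f x : R) *: (x : P).
Proof.
move=> us fs; rewrite [RHS](bigID [in free_supp f]) /= [X in _ + X]big1 => [|x].
  rewrite addr0 -big_filter; apply: perm_big; apply: uniq_perm.
  - exact: undup_uniq.
  - exact: filter_uniq.
  - by move=> x; rewrite mem_undup mem_filter andb_idr //; apply: fs.
by move=> /free_suppP ->; rewrite scale0r.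
Qed.

Lemma free_eval_linear : linear free_eval.
Proof.
move=> r f g; pose s := undup (free_supp (r *: f + g) ++
  free_supp f ++ free_supp g).
have us : uniq s by apply: undup_uniq.
rewrite !(@free_evalE _ s) //; try by move=> x xs;
  rewrite mem_undup !mem_cat xs ?orbT.
rewrite scaler_sumr -big_split; apply: eq_bigr => x _ /=.
by rewrite scalerA -scalerDl.
Qed.

HB.instance Definition _ :=
  GRing.isLinear.Build R free_mod P *:%R free_eval free_eval_linear.

Lemma free_eval_surj : surjective free_eval.
Proof.
move=> p; pose f x : R^o := (x == p)%:R.
have ff : f \in finsupp.
  by apply/asboolP; exists [:: p] => x; rewrite inE /f => /negPf ->.
exists (FreeMod ff).
rewrite (@free_evalE _ (undup (p :: free_supp (FreeMod ff)))) ?undup_uniq //.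
  rewrite (bigD1_seq p) ?undup_uniq ?mem_undup ?mem_head //=.
  by rewrite /f eqxx scale1r big1 ?addr0 // => x /negPf ->; rewrite scale0r.
by move=> x xs; rewrite mem_undup inE xs orbT.
Qed.

End FreeModule.

Section ProjectiveFlat.
Variables (R : pzRingType) (P : lmodType R).
Hypothesis projP : projective P.

Lemma projective_section :
  exists h : {linear P -> free_mod P}, forall x, free_eval (h x) = x.
Proof. exact: (projP (lin_id P)) (@free_eval_surj R P). Qed.

Lemma projective_flat : flat P.
Proof.
have [h hP] := projective_section.
pose b (A : lmodType R^c) (x : P) (a : A) (m : P) : A := (h m x : R^c) *: a.
have bb A x : balanced (b A x).
  split=> [a a' m|a m m'|r a m]; rewrite /b.
  - exact: scalerDr.
  - by rewrite raddfD; apply: scalerDl.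
  - by rewrite linearZ scalerA.
have decomp A (z : tensor A P) : exists s : seq P, forall t : seq P, uniq t ->
    {subset s <= t} -> z = \sum_(x <- t) tens (tensor_lift (b A x) z) x.
  elim/tensor_ind: z => [a m||u v [s sP] [t tP]].
  - exists (free_supp (h m)) => t ut st.
    rewrite -[in LHS](hP m) (free_evalE ut st).
    rewrite (big_morph (tens a) (tensDr a) (tens0r _ a)).
    by apply: eq_bigr => x _; rewrite -tensZ tensor_lift_tens.
  - exists [::] => t _ _; rewrite big1 // => x _.
    by rewrite tensor_lift0 // tens0l.
  - exists (s ++ t) => w uw stw.
    rewrite [in LHS](sP w uw) => [|x xs]; last by apply: stw; rewrite mem_cat xs.
    rewrite [in X in _ - X](tP w uw) => [|x xt]; last first.
      by apply: stw; rewrite mem_cat xt orbT.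
    rewrite -sumrB; apply: eq_bigr => x _; rewrite tensor_liftB //.
    by apply/eqP; rewrite subr_eq -tensDl subrK.
move=> A B f finj; have fb := tensor_map_balanced P f.
suff ker0 z : tensor_map P f z = 0 -> z = 0.
  move=> u v uv; apply/eqP; rewrite -subr_eq0; apply/eqP/ker0.
  by rewrite /tensor_map tensor_liftB //; apply/eqP; rewrite subr_eq0; apply/eqP.
move=> fz0; have [s sP] := decomp A z.
rewrite (sP (undup s) (undup_uniq s)) => [|x]; last by rewrite mem_undup.
rewrite big1 // => x _; suff -> : tensor_lift (b A x) z = 0 by rewrite tens0l.
apply: finj; rewrite raddf0 -[RHS](tensor_lift0 (bb B x)) -fz0.
elim/tensor_ind: z {fz0 s sP} => [a m||u v IHu IHv].
- by rewrite tensor_map_tens !tensor_lift_tens // linearZ.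
- by rewrite /tensor_map !tensor_lift0 // raddf0.
- by rewrite /tensor_map !tensor_liftB // linearB IHu IHv.
Qed.

End ProjectiveFlat.

Definition Prj (R : pzRingType) : preadditive :=
  full_sub (fun M : Mod R => projective (M : lmodType R)).

Definition Flat (R : pzRingType) : preadditive :=
  full_sub (fun M : Mod R => flat (M : lmodType R)).

Definition prj_flat_incl (R : pzRingType) : additive_functor (Prj R) (Flat R) :=
  full_incl (C := Mod R) (@projective_flat R).

Definition j_shriek (N : nat) (R : pzRingType) :
    functor (KN N (Prj R)) (KN N (Flat R)) :=
  KN_functor N (prj_flat_incl R).

(* Main.v *)
(** Every N-complex Y of modules admits a degreewise surjection P -> Y, with P a
    complex of free modules and kernel W such that Ext^1(T, W) = 0 in the
    degreewise split exact structure for every complex T of projectives. Chain maps Q -> Y from a complex of projectives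
    then lift to P, by correcting a degreewise lift, and the lift is unique up
    to homotopy because Hom_K(Q, W) = Ext^1(SQ, W) = 0 for the suspension SQ.

    P is a small object argument without ordinals: its basis is an inductive
    type whose constructors add, for each extension of a countably based
    complex by W, the elements that split it. Each complex Q of projectives is
    a direct summand of a complex of free modules, because d may be replaced by
    h d p for projections p of free modules onto the terms of Q and sections h
    of them; and Ext vanishing passes from countable bases to all bases by
    Zorn's lemma, since every basis element lies in a countable set of basis
    elements closed under d. *)

From HB Require Import structures.
From mathcomp Require Import all_boot all_algebra.
From mathcomp Require Import generic_quotient boolp classical_sets functions zify.
Require Import Defs.

Set Implicit Arguments.
Unset Strict Implicit.
Unset Printing Implicit Defensive.

Import GRing.Theory.
Local Open Scope ring_scope.
Local Open Scope cat_scope.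

(** * Linear maps and free modules *)

(** Choosing a couniversal arrow [e y] for each [y] gives [G] on objects; uniqueness of
    factorizations through [e y] forces functoriality and naturality. *)
Lemma right_adjoint_of_couniversal (C D : category) (F : functor C D) :
  (forall y : D, exists (p : C) (e : hom (F p) y),
     forall (x : C) (g : hom (F x) y), exists! f : hom x p, comp e (fmap F f) = g) ->
  exists G : functor D C, left_adjoint_to F G.
Proof.
move=> univ.
pose Go y := projT1 (cid (univ y)).
pose e y : hom (F (Go y)) y := projT1 (cid (projT2 (cid (univ y)))).
have eP y x (g : hom (F x) y) : exists! f : hom x (Go y), comp (e y) (fmap F f) = g.
  exact: (projT2 (cid (projT2 (cid (univ y))))).
pose lft (x : C) (y : D) (g : hom (F x) y) : hom x (Go y) := projT1 (cid (eP y x g)).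
have lftP x y (g : hom (F x) y) : comp (e y) (fmap F (lft x y g)) = g.
  by rewrite /lft; case: cid => f /= [].
have lftU x y (f : hom x (Go y)) : lft x y (comp (e y) (fmap F f)) = f.
  by rewrite /lft; case: cid => f' /= [_]; apply.
have lft_nat x x' y (f : hom x' x) (g : hom (F x) y) :
    lft x' y (comp g (fmap F f)) = comp (lft x y g) f.
  by rewrite -[RHS]lftU fmapM compmA lftP.
pose G_map (y y' : D) (h : hom y y') : hom (Go y) (Go y') := lft _ _ (comp h (e y)).
have G1 y : G_map y y (idm y) = idm (Go y).
  by rewrite -[RHS]lftU fmap1 compm1 /G_map comp1m.
have GM x y z (h : hom y z) (k : hom x y) :
    G_map x z (comp h k) = comp (G_map y z h) (G_map x y k).
  by rewrite -lft_nat -compmA lftP compmA.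
exists (@Functor D C Go G_map G1 GM), lft; split.
- move=> x y; exists (fun f => comp (e y) (fmap F f)) => [g|f]; last exact: lftU.
  exact: lftP.
- by move=> x x' y f u; apply: lft_nat.
- by move=> x y y' g u /=; rewrite -lft_nat -compmA lftP.
Qed.

Section LinearTools.
Variable R : pzRingType.

Definition lin_of (M P : lmodType R) (f : M -> P) (fL : linear f) :
    {linear M -> P} :=
  HB.pack f (GRing.isLinear.Build R M P *:%R f fL).

Lemma lin_subE (M P : lmodType R) (f g : {linear M -> P}) x :
  (f - g) x = f x - g x.
Proof. by []. Qed.

Definition lin_iter (M : lmodType R) (f : {linear M -> M}) (n : nat) :
    {linear M -> M} :=
  iter n (lin_comp f) (lin_id M).

Lemma lin_iterS (M : lmodType R) (f : {linear M -> M}) n x :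
  lin_iter f n.+1 x = f (lin_iter f n x).
Proof. by []. Qed.

Lemma lin_iterSr (M : lmodType R) (f : {linear M -> M}) n x :
  lin_iter f n.+1 x = lin_iter f n (f x).
Proof. by elim: n x => [|n IHn] x //; rewrite lin_iterS IHn. Qed.

Lemma lin_iterD (M : lmodType R) (f : {linear M -> M}) m n x :
  lin_iter f (m + n) x = lin_iter f m (lin_iter f n x).
Proof. by elim: m => [|m IHm] //; rewrite addSn !lin_iterS IHm. Qed.

(** Submodules are predicates on an ambient module, so that graded pieces are compared without
    transport along equalities of degrees. *)
Definition is_submod (M : lmodType R) (V : M -> Prop) :=
  V 0 /\ forall r x y, V x -> V y -> V (r *: x + y).

Section SubmodTheory.
Variables (M : lmodType R) (V : M -> Prop).
Hypothesis subV : is_submod V.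

Lemma submod0 : V 0. Proof. exact: subV.1. Qed.

Lemma submodZD r x y : V x -> V y -> V (r *: x + y).
Proof. exact: subV.2. Qed.

Lemma submodD x y : V x -> V y -> V (x + y).
Proof. by rewrite -[x in X in _ -> _ -> X]scale1r; apply: submodZD. Qed.

Lemma submodZ r x : V x -> V (r *: x).
Proof. by move=> Vx; rewrite -[_ *: _]addr0; apply: submodZD => //; apply: submod0. Qed.

Lemma submodN x : V x -> V (- x).
Proof. by rewrite -scaleN1r; apply: submodZ. Qed.

Lemma submodB x y : V x -> V y -> V (x - y).
Proof. by move=> Vx /submodN; apply: submodD. Qed.

Lemma submod_sum (I : Type) (r : seq I) (P : pred I) (F : I -> M) :
  (forall i, P i -> V (F i)) -> V (\sum_(i <- r | P i) F i).
Proof. by move=> VF; apply: big_ind => //; [apply: submod0 | apply: submodD]. Qed.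

End SubmodTheory.

Lemma submod_preim (M P : lmodType R) (f : {linear M -> P}) (V : P -> Prop) :
  is_submod V -> is_submod (fun x => V (f x)).
Proof.
move=> subV; split=> [|r x y Vx Vy]; first by rewrite linear0; apply: submod0.
by rewrite linearP; apply: submodZD.
Qed.

Lemma submod_eq (M P : lmodType R) (f g : {linear M -> P}) :
  is_submod (fun x => f x = g x).
Proof.
by split=> [|r x y fgx fgy]; rewrite ?linear0 // !linearP fgx fgy.
Qed.

End LinearTools.

(* The free module on [K]; [free_mod] of the definitions only covers the case
   where [K] is the carrier of a module. *)
Section FinitelySupported.
Variables (R : pzRingType) (K : eqType).

Definition fs_pred : {pred K -> R^o} :=
  fun f => `[< exists s : seq K, forall k, k \notin s -> f k = 0 >].

Lemma fs_pred_closed : submod_closed fs_pred.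
Proof.
split=> [|r f g /asboolP[s sf] /asboolP[t tg]]; apply/asboolP.
  by exists [::].
exists (s ++ t) => k; rewrite mem_cat negb_or => /andP[ks kt].
by rewrite -[LHS]/(r *: f k + g k) sf // tg // scaler0 addr0.
Qed.

HB.instance Definition _ :=
  GRing.isSubmodClosed.Build R (K -> R^o) fs_pred fs_pred_closed.

Record fsmod := FsMod { fs_fun :> K -> R^o; _ : fs_fun \in fs_pred }.

HB.instance Definition _ := [isSub for fs_fun].
HB.instance Definition _ := [Choice of fsmod by <:].
HB.instance Definition _ := [SubChoice_isSubLmodule of fsmod by <:].

Implicit Types (x y : fsmod) (k : K).

Lemma fsP x y : x =1 y -> x = y.
Proof. by move=> /funext xy; apply: val_inj. Qed.

Lemma fsZDE r x y k : (r *: x + y) k = r * x k + y k.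
Proof. by []. Qed.

Lemma fs_delta_subproof k : (fun k' => (k' == k)%:R : R^o) \in fs_pred.
Proof. by apply/asboolP; exists [:: k] => k'; rewrite inE => /negPf->. Qed.

Definition delta k : fsmod := FsMod (fs_delta_subproof k).

Lemma fs_supp_ex x : exists s : seq K, uniq s /\ forall k, k \notin s -> x k = 0.
Proof.
case: x => f fP /=; move/asboolP: (fP) => [s sP].
by exists (undup s); split=> [|k]; rewrite ?undup_uniq // mem_undup; apply: sP.
Qed.

Definition fs_supp x : seq K := projT1 (cid (fs_supp_ex x)).

Lemma fs_supp_uniq x : uniq (fs_supp x).
Proof. by rewrite /fs_supp; case: cid => s []. Qed.

Lemma fs_suppP x k : k \notin fs_supp x -> x k = 0.
Proof. by rewrite /fs_supp; case: cid => s [us] /= sP /sP. Qed.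

Section Lift.
Variables (M : lmodType R) (a : K -> M).

Definition fs_lift_fun x : M := \sum_(k <- fs_supp x) (x k : R) *: a k.

(** Any duplicate-free list covering the support gives the same sum, so vectors with different
    chosen supports can be treated on a common list. *)
Lemma fs_lift_funE x (s : seq K) : uniq s -> (forall k, k \notin s -> x k = 0) ->
  fs_lift_fun x = \sum_(k <- s) (x k : R) *: a k.
Proof.
move=> us sP; rewrite /fs_lift_fun.
rewrite (bigID [in s]) /= [X in _ + X]big1 => [|k /sP ->]; last by rewrite scale0r.
rewrite [RHS](bigID [in fs_supp x]) /= [X in _ = _ + X]big1 => [|k /fs_suppP ->].
  rewrite !addr0 -[LHS]big_filter -[RHS]big_filter; apply: perm_big; apply: uniq_perm.
  - by rewrite filter_uniq // fs_supp_uniq.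
  - exact: filter_uniq.
  - by move=> k; rewrite !mem_filter andbC.
by rewrite scale0r.
Qed.

Lemma fs_lift_linear : linear fs_lift_fun.
Proof.
move=> r x y; pose s := undup (fs_supp x ++ fs_supp y).
have us : uniq s by apply: undup_uniq.
have sx k : k \notin s -> x k = 0.
  by rewrite mem_undup mem_cat negb_or => /andP[/fs_suppP].
have sy k : k \notin s -> y k = 0.
  by rewrite mem_undup mem_cat negb_or => /andP[_ /fs_suppP].
rewrite !(@fs_lift_funE _ s) // => [|k ks]; last first.
  by rewrite fsZDE sx // sy // mulr0 addr0.
rewrite scaler_sumr -big_split; apply: eq_bigr => k _ /=.
by rewrite scalerA -scalerDl.
Qed.

Lemma fs_lift_subproof : {f : {linear fsmod -> M} | forall k, f (delta k) = a k}.
Proof.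
exists (lin_of fs_lift_linear) => k.
rewrite /= (@fs_lift_funE _ [:: k]) // => [|k' /=]; last first.
  by rewrite inE => /negPf->.
by rewrite big_seq1 /= eqxx scale1r.
Qed.

Definition fs_lift : {linear fsmod -> M} := sval fs_lift_subproof.

Lemma fs_lift_delta k : fs_lift (delta k) = a k.
Proof. exact: svalP fs_lift_subproof k. Qed.

End Lift.

Definition supp_in (S : K -> Prop) x := forall k, ~ S k -> x k = 0.

Lemma supp_in_submod S : is_submod (supp_in S).
Proof.
split=> [//|r x y Sx Sy k nSk].
by rewrite fsZDE Sx // Sy // mulr0 addr0.
Qed.

Lemma supp_in_delta (S : K -> Prop) k : S k -> supp_in S (delta k).
Proof.
move=> Sk k' nSk' /=; case: eqP => // kk'.
by case: nSk'; rewrite kk'.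
Qed.

Lemma supp_in_sub (S T : K -> Prop) x :
  (forall k, S k -> T k) -> supp_in S x -> supp_in T x.
Proof. by move=> ST Sx k nTk; apply: Sx => /ST. Qed.

Lemma fs_expand x : x = \sum_(k <- fs_supp x) (x k : R) *: delta k.
Proof.
apply: fsP => k0.
rewrite -[RHS]/(fs_fun _ k0).
have -> : fs_fun (\sum_(k <- fs_supp x) (x k : R) *: delta k) k0 =
   \sum_(k <- fs_supp x) ((x k : R) * (k0 == k)%:R).
  by elim: (fs_supp x) => [|k s IHs]; rewrite ?big_nil ?big_cons ?fsZDE ?IHs.
have [k0x|k0x] := boolP (k0 \in fs_supp x).
  rewrite (bigD1_seq k0) ?fs_supp_uniq //= eqxx mulr1 big1 ?addr0 // => k.
  by rewrite eq_sym => /negPf ->; rewrite mulr0.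
rewrite fs_suppP // big_seq big1 // => k kx.
by case: eqP => [k0k|]; rewrite ?mulr0 //; rewrite k0k kx in k0x.
Qed.

Lemma supp_in_ind (S : K -> Prop) (V : fsmod -> Prop) : is_submod V ->
  (forall k, S k -> V (delta k)) -> forall x, supp_in S x -> V x.
Proof.
move=> subV Vd x Sx; rewrite (fs_expand x); apply: (submod_sum subV) => k _.
have [/Vd|nSk] := EM (S k); first exact: submodZ.
by rewrite Sx // scale0r; apply: submod0.
Qed.

Lemma fs_ind (V : fsmod -> Prop) : is_submod V ->
  (forall k, V (delta k)) -> forall x, V x.
Proof.
by move=> subV Vd x; apply: (@supp_in_ind (fun=> True)) => // k; case.
Qed.

Lemma fs_lin_eq (M : lmodType R) (f g : {linear fsmod -> M}) :
  (forall k, f (delta k) = g (delta k)) -> forall x, f x = g x.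
Proof. by move=> fg x; move: x; apply: fs_ind => //; apply: submod_eq. Qed.

Lemma supp_in_lin_eq (S : K -> Prop) (M : lmodType R) (f g : {linear fsmod -> M}) :
  (forall k, S k -> f (delta k) = g (delta k)) ->
  forall x, supp_in S x -> f x = g x.
Proof. by move=> fg x; move: x; apply: supp_in_ind => //; apply: submod_eq. Qed.

Lemma supp_in_lin (S : K -> Prop) (M : lmodType R) (f : {linear fsmod -> M})
    (V : M -> Prop) : is_submod V ->
  (forall k, S k -> V (f (delta k))) -> forall x, supp_in S x -> V (f x).
Proof. by move=> subV; apply: supp_in_ind; apply: submod_preim. Qed.

Lemma supp_in_fs_supp x : supp_in (fun k => k \in fs_supp x) x.
Proof. by move=> k /negP /fs_suppP. Qed.

End FinitelySupported.
Arguments supp_in_submod {R K} S.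
Arguments supp_in_delta {R K S k} _.

(** * Ext vanishing from countable to arbitrary bases *)

Section Cocycle.
Variables (R : pzRingType) (F E : lmodType R).
Variables (d : {linear E -> E}) (bd : {linear F -> F}) (u : {linear F -> E}).

(* The value of d^n w - w bd^n forced by d w - w bd = u. *)
Fixpoint cocycle (n : nat) : {linear F -> E} :=
  if n is m.+1 then lin_comp d (cocycle m) + lin_comp u (lin_iter bd m) else 0.

Lemma cocycleS n x : cocycle n.+1 x = d (cocycle n x) + u (lin_iter bd n x).
Proof. by []. Qed.

End Cocycle.

(** For u = d w - w bd the sum of the terms d^(n-1-j) u bd^j telescopes. *)
Lemma cocycle_boundary (R : pzRingType) (F E : lmodType R) (d : {linear E -> E})
    (bd : {linear F -> F}) (u w : {linear F -> E}) :
  (forall x, u x = d (w x) - w (bd x)) ->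
  forall n x, cocycle d bd u n x = lin_iter d n (w x) - w (lin_iter bd n x).
Proof.
move=> uE; elim=> [|n IHn] x; first by rewrite subrr.
by rewrite cocycleS IHn linearB uE addrA subrK.
Qed.

Lemma cocycleB (R : pzRingType) (F E : lmodType R) (d : {linear E -> E})
    (bd : {linear F -> F}) (u v : {linear F -> E}) n x :
  cocycle d bd (u - v) n x = cocycle d bd u n x - cocycle d bd v n x.
Proof.
elim: n => [|n IHn]; first by rewrite subrr.
by rewrite !cocycleS IHn linearB opprD addrACA.
Qed.

Section ExtVanishing.
Variables (R : pzRingType) (N : nat) (E : lmodType R) (d : {linear E -> E}).
Variable W : int -> E -> Prop.
Hypothesis W_submod : forall i, is_submod (W i).
Hypothesis W_d : forall i x, W i x -> W (i + 1) (d x).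
Hypothesis N_gt0 : (0 < N)%N.
Hypothesis W_dN : forall i x, W i x -> lin_iter d N x = 0.

(* Ext^1(T, W) = 0 for every N-complex T of free modules with basis [B],
   homogeneous of degree [deg] and with differential [bd]: an extension is
   given by a degree 1 map [u] with vanishing cocycle sum, and a splitting of
   it by [w]. *)
Definition ext_vanish (B : eqType) : Prop :=
  forall (deg : B -> int) (bd : {linear fsmod R B -> fsmod R B})
      (u : {linear fsmod R B -> E}),
    (forall b, supp_in (fun b' => deg b' = deg b + 1) (bd (delta R b))) ->
    (forall x, lin_iter bd N x = 0) ->
    (forall b, W (deg b + 1) (u (delta R b))) ->
    (forall x, cocycle d bd u N x = 0) ->
  exists w : {linear fsmod R B -> E},
    (forall b, W (deg b) (w (delta R b))) /\
    (forall x, d (w x) - w (bd x) = u x).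

Section Kaplansky.
Hypothesis ext_nat : ext_vanish nat.
Variables (B : eqType) (deg : B -> int).
Variables (bd : {linear fsmod R B -> fsmod R B}) (u : {linear fsmod R B -> E}).
Hypothesis bd_deg :
  forall b, supp_in (fun b' => deg b' = deg b + 1) (bd (delta R b)).
Hypothesis bdN : forall x, lin_iter bd N x = 0.
Hypothesis uW : forall b, W (deg b + 1) (u (delta R b)).
Hypothesis u_cocycle : forall x, cocycle d bd u N x = 0.

Definition bd_closed (S : B -> Prop) :=
  forall b, S b -> supp_in S (bd (delta R b)).

(** Extending [w] by 0 off [S] gives all partial splittings one type and lets them be enlarged by
    adding a map. *)
Definition partial_split (S : B -> Prop) (w : {linear fsmod R B -> E}) :=
  [/\ bd_closed S,
      forall b, ~ S b -> w (delta R b) = 0,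
      forall b, S b -> W (deg b) (w (delta R b))
    & forall b, S b -> d (w (delta R b)) - w (bd (delta R b)) = u (delta R b)].

Lemma bd_closed_supp (S : B -> Prop) x : bd_closed S -> supp_in S x ->
  supp_in S (bd x).
Proof.
by move=> Scl; move: x; apply: supp_in_lin => //; apply: supp_in_submod.
Qed.

(** * Countable closures of single basis elements *)

Section Closure.
Variable b0 : B.

Definition closure_step (s : seq B) : seq B :=
  flatten [seq fs_supp (bd (delta R b)) | b <- s].

(** An enumeration with repetitions: [k] codes a stage [n] and a position [m] in its list. Indices
    without meaning go to [b0], which lies in the closure anyway. *)
Definition closure_enum (k : nat) : B :=
  if unpickle k is Some (n, m) then nth b0 (iter n closure_step [:: b0]) m else b0.

Definition in_closure (b : B) := exists k, closure_enum k = b.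

Lemma in_closureP b : in_closure b <-> exists n, b \in iter n closure_step [:: b0].
Proof.
split=> [[k <-]|[n bn]].
  rewrite /closure_enum; case: unpickle => [[n m]|]; last first.
    by exists 0; rewrite /= mem_head.
  have [mn|mn] := ltnP m (size (iter n closure_step [:: b0])).
    by exists n; apply: mem_nth.
  by rewrite nth_default //; exists 0; rewrite /= mem_head.
exists (pickle (n, index b (iter n closure_step [:: b0]))).
by rewrite /closure_enum pickleK nth_index.
Qed.

Lemma in_closure_base : in_closure b0.
Proof. by apply/in_closureP; exists 0; rewrite /= mem_head. Qed.

Lemma in_closure_closed : bd_closed in_closure.
Proof.
move=> b /in_closureP[n bn]; apply: supp_in_sub (@supp_in_fs_supp _ _ _) => b' b'b.
apply/in_closureP; exists n.+1 => /=; apply/flattenP.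
by exists (fs_supp (bd (delta R b))) => //; apply: map_f.
Qed.

End Closure.

(** * Extending a partial splitting over one closure *)

Section Extension.
Variables (S : B -> Prop) (w : {linear fsmod R B -> E}) (b0 : B).
Hypothesis Sw : partial_split S w.

Let C := in_closure b0.
Let c := closure_enum b0.
Let S' b := S b \/ C b.

Let S_closed : bd_closed S. Proof. by case: Sw. Qed.
Let w_off b : ~ S b -> w (delta R b) = 0. Proof. by case: Sw => _ + _ _; apply. Qed.

Let S'_closed : bd_closed S'.
Proof.
move=> b [Sb|Cb].
  by apply: supp_in_sub (S_closed Sb) => b'; left.
by apply: supp_in_sub (in_closure_closed Cb) => b'; right.
Qed.

Let rank b : nat := if pselect (C b) is left Cb then projT1 (cid Cb) else 0.

Let rankK b : C b -> c (rank b) = b.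
Proof. by rewrite /rank; case: pselect => // Cb _; case: cid. Qed.

(* The new basis elements are those of the closure of [b0] outside [S];
   each is represented by a single index. *)
Let selected k := `[< ~ S (c k) /\ rank (c k) = k >].
Let inc : {linear fsmod R nat -> fsmod R B} :=
  fs_lift (fun k => if selected k then delta R (c k) else 0).
Let ret : {linear fsmod R B -> fsmod R nat} :=
  fs_lift (fun b => if `[< C b /\ ~ S b >] then delta R (rank b) else 0).

Let inc_delta k : inc (delta R k) = if selected k then delta R (c k) else 0.
Proof. exact: fs_lift_delta. Qed.

Let ret_delta b : C b -> ~ S b -> ret (delta R b) = delta R (rank b).
Proof.
by move=> Cb nSb; rewrite fs_lift_delta; case: asboolP => // -[].
Qed.

Let ret_S x : supp_in S x -> ret x = 0.
Proof.
apply: (supp_in_ind (submod_eq ret (0 : {linear fsmod R B -> fsmod R nat}))) => b Sb.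
by rewrite fs_lift_delta; case: asboolP => // -[].
Qed.

Let inc_S' x : supp_in S' (inc x).
Proof.
move: x; apply: fs_ind => [|k].
  exact/submod_preim/supp_in_submod.
rewrite inc_delta; case: ifP => _; last exact: submod0 (supp_in_submod S').
by apply: supp_in_delta; right; exists k.
Qed.

Let inc_ret_delta b : C b -> ~ S b -> inc (ret (delta R b)) = delta R b.
Proof.
move=> Cb nSb; rewrite ret_delta // inc_delta rankK //.
by rewrite /selected rankK //; case: asboolP => // -[].
Qed.

Let inc_ret x : supp_in S' x -> supp_in S (inc (ret x) - x).
Proof.
pose g : {linear fsmod R B -> fsmod R B} := lin_comp inc ret - lin_id _.
apply: (@supp_in_lin _ _ _ _ g) => [|b S'b]; first exact: supp_in_submod.
rewrite -[g _]/(inc (ret (delta R b)) - delta R b).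
have [Sb|nSb] := EM (S b).
  have dS : supp_in S (delta R b) := supp_in_delta Sb.
  by rewrite ret_S // linear0; apply: (submodB (supp_in_submod S)) => //; apply: (submod0 (supp_in_submod S)).
have Cb : C b by case: S'b.
by rewrite inc_ret_delta // subrr; apply: submod0 (supp_in_submod S).
Qed.

(** The differential of the quotient of the complex on [S'] by the one on [S], written on the
    selected indices; it is 0 on the other indices. *)
Let bd1 : {linear fsmod R nat -> fsmod R nat} :=
  lin_comp ret (lin_comp bd inc).
(** What remains to be split. It vanishes over [S], where [w] already splits [u], and so factors
    through the quotient. *)
Let u2 : {linear fsmod R B -> E} := u - (lin_comp d w - lin_comp w bd).
Let u1 : {linear fsmod R nat -> E} := lin_comp u2 inc.

Let bd1E x : bd1 x = ret (bd (inc x)). Proof. by []. Qed.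
Let u2E x : u2 x = u x - (d (w x) - w (bd x)). Proof. by []. Qed.

Let u2_S x : supp_in S x -> u2 x = 0.
Proof.
apply: (supp_in_ind (submod_eq u2 (0 : {linear fsmod R B -> E}))) => b Sb.
by rewrite u2E; case: Sw => _ _ _ ->; rewrite ?subrr.
Qed.

Let w_deg i x : supp_in (fun b => deg b = i) x -> W i (w x).
Proof.
apply: supp_in_lin => // b <-.
by have [Sb|/w_off ->] := EM (S b); [case: Sw => _ _ + _; apply | apply: submod0].
Qed.

Let u2_W b : W (deg b + 1) (u2 (delta R b)).
Proof.
rewrite u2E; do ![apply: submodB => //]; last exact/w_deg/bd_deg.
by apply: W_d; apply: w_deg; apply: supp_in_delta.
Qed.

Let w_dN x : lin_iter d N (w x) = 0.
Proof.
move: x; apply: (fs_ind (submod_eq (lin_comp (lin_iter d N) w)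
  (0 : {linear fsmod R B -> E}))) => b.
by apply: (@W_dN (deg b)); apply: w_deg; apply: supp_in_delta.
Qed.

Let u2_cocycle x : cocycle d bd u2 N x = 0.
Proof.
rewrite cocycleB u_cocycle.
rewrite (@cocycle_boundary _ _ _ d bd (lin_comp d w - lin_comp w bd) w) //.
by rewrite w_dN bdN linear0 !subrr.
Qed.

(** [inc] commutes with the differentials only modulo vectors supported in [S]. This suffices,
    because [ret] and [u2] vanish on those. *)
Let inc_bd1_iter n x : supp_in S (inc (lin_iter bd1 n x) - lin_iter bd n (inc x)).
Proof.
elim: n => [|n IHn]; first by rewrite subrr; apply: submod0 (supp_in_submod S).
rewrite !lin_iterS bd1E -[X in X - _](subrK (bd (inc (lin_iter bd1 n x)))) -addrA.
apply: (submodD (supp_in_submod S)); first by apply: inc_ret; apply: (bd_closed_supp S'_closed).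
by rewrite -linearB; apply: (bd_closed_supp S_closed).
Qed.

Let bd1N x : lin_iter bd1 N x = 0.
Proof.
case: N N_gt0 bdN => // m _ bdS; rewrite lin_iterS bd1E.
have := bd_closed_supp S_closed (inc_bd1_iter m x).
rewrite linearB -lin_iterS bdS subr0; exact: ret_S.
Qed.

Let u1_cocycle n x : cocycle d bd1 u1 n x = cocycle d bd u2 n (inc x).
Proof.
elim: n => [//|n IHn]; rewrite !cocycleS IHn; congr (_ + _).
rewrite -[u1 _]/(u2 (inc (lin_iter bd1 n x))); apply/eqP.
by rewrite -subr_eq0 -linearB u2_S.
Qed.

Let u1_W k : W (deg (c k) + 1) (u1 (delta R k)).
Proof.
rewrite -[u1 _]/(u2 (inc (delta R k))) inc_delta; case: ifP => _ //.
by rewrite linear0; apply: submod0.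
Qed.

Let bd1_deg k :
  supp_in (fun k' => deg (c k') = deg (c k) + 1) (bd1 (delta R k)).
Proof.
rewrite bd1E inc_delta; case: ifP => _; last first.
  by rewrite !linear0; apply: submod0 (supp_in_submod _).
apply: (supp_in_lin (f := ret) (supp_in_submod _) _ (@bd_deg (c k))) => b bE.
rewrite fs_lift_delta; case: asboolP => [[Cb _]|_]; last first.
  exact: submod0 (supp_in_submod _).
by apply: supp_in_delta; rewrite rankK.
Qed.

(** The quotient by the complex on [S] has a countable basis, so [ext_nat] splits the remaining
    extension by some [w1]; then [w] plus [w1] after [ret] is a splitting over [S] and the closure
    of [b0]. *)
Lemma partial_split_extend : exists (T : B -> Prop) (v : {linear fsmod R B -> E}),
  [/\ partial_split T v, forall b, S b -> T b,
      forall b, S b -> v (delta R b) = w (delta R b) & T b0].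
Proof.
have [|w1 [w1W w1E]] := ext_nat bd1_deg bd1N u1_W.
  by move=> x; rewrite u1_cocycle u2_cocycle.
pose v : {linear fsmod R B -> E} := w + lin_comp w1 ret.
have vE x : v x = w x + w1 (ret x) by [].
have v_S x : supp_in S x -> v x = w x.
  by move=> Sx; rewrite vE ret_S // linear0 addr0.
exists S', v; split; last 1 first.
- by right; apply: in_closure_base.
- split=> // [b nS'b|b S'b|b S'b].
  + rewrite vE w_off => [|Sb]; last by apply: nS'b; left.
    rewrite fs_lift_delta; case: asboolP => [[Cb _]|_]; last by rewrite linear0 add0r.
    by case: nS'b; right.
  + have [Sb|nSb] := EM (S b).
      by rewrite v_S; [case: Sw => _ _ + _; apply | apply: supp_in_delta].
    have Cb : C b by case: S'b.
    rewrite vE w_off // add0r ret_delta //.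
    by have := w1W (rank b); rewrite rankK.
  have [Sb|nSb] := EM (S b).
    rewrite !v_S; [|exact: S_closed|exact: supp_in_delta].
    by case: Sw => _ _ _; apply.
  have Cb : C b by case: S'b.
  rewrite !vE linearD opprD addrACA.
  have -> : ret (bd (delta R b)) = bd1 (ret (delta R b)).
    by rewrite bd1E inc_ret_delta.
  rewrite w1E -[u1 _]/(u2 (inc (ret (delta R b)))) inc_ret_delta // u2E.
  by rewrite addrC subrK.
- by move=> b; left.
- by move=> b Sb; rewrite v_S //; apply: supp_in_delta.
Qed.

End Extension.

(** * Zorn's lemma for partial splittings *)

Let split_type := {p : (B -> Prop) * {linear fsmod R B -> E} | partial_split p.1 p.2}.

Let split_le (p q : split_type) : bool :=
  `[< (forall b, (sval p).1 b -> (sval q).1 b) /\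
      forall b, (sval p).1 b -> (sval q).2 (delta R b) = (sval p).2 (delta R b) >].

(** The upper bound is the union of the domains. At [b] the splitting takes the value of any member
    defined there; totality of the order makes the choice irrelevant. *)
Let split_chain (A : set split_type) : total_on A split_le ->
  exists t, forall s, A s -> split_le s t.
Proof.
move=> Atot; pose S b := exists p : split_type, A p /\ (sval p).1 b.
pose w := fs_lift (fun b =>
  if pselect (S b) is left Sb then (sval (projT1 (cid Sb))).2 (delta R b) else 0).
have wE (p : split_type) b : A p -> (sval p).1 b ->
    w (delta R b) = (sval p).2 (delta R b).
  move=> Ap pb; rewrite fs_lift_delta; case: pselect => [Sb|[]]; last by exists p.
  case: cid => q [Aq qb] /=; case: (Atot p q Ap Aq) => /asboolP[_].
    by move=> /(_ b pb).
  by move=> /(_ b qb) ->.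
have wE' (p : split_type) x : A p -> supp_in (sval p).1 x -> w x = (sval p).2 x.
  by move=> Ap; apply: supp_in_lin_eq => b; apply: wE.
have Sw : partial_split S w.
  split=> [b [p [Ap pb]]|b nSb|b [p [Ap pb]]|b [p [Ap pb]]]; last 2 first.
  - by rewrite (wE p) //; case: (svalP p) => _ _ + _; apply.
  - case: (svalP p) => pcl _ _ /(_ b pb) <-.
    by rewrite !(wE' p) //; [exact: pcl | exact: supp_in_delta].
  - case: (svalP p) => /(_ b pb) pS _ _ _.
    by apply: supp_in_sub pS => b' pb'; exists p.
  by rewrite fs_lift_delta; case: pselect.
exists (exist _ (S, w) Sw) => p Ap; apply/asboolP; split=> b pb /=; first by exists p.
exact: wE.
Qed.

Lemma ext_any : exists w : {linear fsmod R B -> E},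
  (forall b, W (deg b) (w (delta R b))) /\
  (forall x, d (w x) - w (bd x) = u x).
Proof.
have S0 : partial_split (fun=> False) 0 by split.
have [|p q r /asboolP[pq1 pq2] /asboolP[qr1 qr2]||[[S w] Sw] Smax] :=
    @ZL_preorder split_type (exist _ (fun=> False, 0) S0) split_le _ _ _.
- by move=> p; apply/asboolP.
- apply/asboolP; split=> b pb; first by apply: qr1; apply: pq1.
  by rewrite qr2 ?pq2 //; apply: pq1.
- exact: split_chain.
(* A maximal domain contains the closure of every [b], since otherwise it could be enlarged. *)
have Sall b : S b.
  have [T [v [Tv ST vw Tb]]] := partial_split_extend b Sw.
  have /asboolP[+ _] : split_le (exist _ (T, v) Tv) (exist _ (S, w) Sw).
    by apply: Smax; apply/asboolP.
  exact.
have [_ _ wW wE] := Sw; exists w; split=> [b|]; first exact: wW.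
pose f : {linear fsmod R B -> E} := lin_comp d w - lin_comp w bd.
by apply: (@fs_lin_eq _ _ _ f) => b; apply: wE.
Qed.

End Kaplansky.

Lemma ext_vanish_any (B : eqType) : ext_vanish nat -> ext_vanish B.
Proof. by move=> ext_nat deg bd u; apply: ext_any. Qed.

End ExtVanishing.

(** * Suspension *)

Lemma lin_sumE (R : pzRingType) (M P : lmodType R) (I : Type) (r : seq I)
    (F : I -> {linear M -> P}) x :
  (\sum_(i <- r) F i) x = \sum_(i <- r) F i x.
Proof. exact: (big_morph (fun f : {linear M -> P} => f x)). Qed.

Section Suspension.
Variables (R : pzRingType) (n : nat) (B : eqType) (deg : B -> int).
Variable bd : {linear fsmod R B -> fsmod R B}.
Local Notation N := n.+2.
Hypothesis bd_deg :
  forall b, supp_in (fun b' => deg b' = deg b + 1) (bd (delta R b)).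
Hypothesis bdN : forall x, lin_iter bd N x = 0.

Let SB : eqType := (B * 'I_n.+1)%type.

(** Copy 0 of [b] sits in degree deg b - N + 1, where a homotopy evaluated at [b] takes its value.
    The N - 1 copies end in degree deg b - 1. *)
Definition susp_deg (p : SB) : int := deg p.1 - N%:Z + 1 + (p.2 : nat)%:Z.

Definition susp_incl (k : nat) : {linear fsmod R B -> fsmod R SB} :=
  fs_lift (fun b => delta R ((b, inord k) : SB)).

(* The suspension is the cokernel of x |-> (bd^j x)_j from the complex to the
   sum of N shifted copies of it, so the last copy is expressed by the others. *)
Definition susp_last : {linear fsmod R B -> fsmod R SB} :=
  - \sum_(j < n.+1) lin_comp (susp_incl (n - j)) (lin_iter bd j.+1).

Definition susp_map (k : nat) : {linear fsmod R B -> fsmod R SB} :=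
  if (k <= n)%N then susp_incl k else susp_last.

Definition susp_bd : {linear fsmod R SB -> fsmod R SB} :=
  fs_lift (fun p : SB => susp_map p.2.+1 (delta R p.1)).

Lemma susp_lastE x :
  susp_last x = - \sum_(j < n.+1) susp_incl (n - j) (lin_iter bd j.+1 x).
Proof. by rewrite -[LHS]/(- (_ : {linear _ -> _}) x) lin_sumE. Qed.

Lemma susp_incl_delta (b : B) (i : 'I_n.+1) :
  delta R ((b, i) : SB) = susp_incl i (delta R b).
Proof. by rewrite fs_lift_delta inord_val. Qed.

Lemma susp_bd_incl k x : (k <= n)%N -> susp_bd (susp_incl k x) = susp_map k.+1 x.
Proof.
move=> kn; move: x; apply: (@fs_lin_eq _ _ _ (lin_comp susp_bd (susp_incl k))) => b.
rewrite -[LHS]/(susp_bd (susp_incl k (delta R b))).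
by rewrite fs_lift_delta fs_lift_delta /= inordK.
Qed.

(** The term j = 0 becomes [susp_last (bd x)], whose expansion cancels the other terms after a shift
    of the index; its top term contains bd^N = 0. *)
Lemma susp_bd_last x : susp_bd (susp_last x) = 0.
Proof.
rewrite susp_lastE linearN linear_sum.
under eq_bigr => j _ do rewrite susp_bd_incl ?leq_subr //.
rewrite big_ord_recl /susp_map subn0 ltnn.
rewrite -[lin_iter bd 1 x]/(bd x) susp_lastE big_ord_recr subnn -lin_iterSr bdN.
rewrite (linear0 (susp_incl 0)) Monoid.mulm1.
under [X in _ + X]eq_bigr => j _.
  rewrite lift0 subnSK // leq_subr lin_iterSr.
  over.
by rewrite addNr oppr0.
Qed.

(** Copy 0 generates the suspension under its differential, so that bd^N = 0 need only be checked
    along these iterates. *)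
Lemma susp_bd_iter m x : (m <= n.+1)%N ->
  lin_iter susp_bd m (susp_incl 0 x) = susp_map m x.
Proof.
elim: m => [//|m IHm] mn; rewrite lin_iterS IHm 1?ltnW // /susp_map.
by rewrite -[(m <= n)%N]/(m < n.+1)%N mn susp_bd_incl.
Qed.

Lemma susp_bdN0 k x : lin_iter susp_bd (k + N) (susp_incl 0 x) = 0.
Proof.
rewrite lin_iterD lin_iterS susp_bd_iter // /susp_map ltnn susp_bd_last.
exact: linear0.
Qed.

Lemma susp_bdN x : lin_iter susp_bd N x = 0.
Proof.
move: x; apply: (@fs_lin_eq _ _ _ _ 0) => -[b i]; rewrite susp_incl_delta.
have := susp_bd_iter (delta R b) (ltnW (ltn_ord i)).
rewrite /susp_map -ltnS ltn_ord => <-.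
by rewrite -lin_iterD addnC susp_bdN0.
Qed.

Lemma bd_iter_deg j b :
  supp_in (fun b' => deg b' = deg b + j%:Z) (lin_iter bd j (delta R b)).
Proof.
elim: j => [|j IHj]; first by apply: supp_in_delta; rewrite addr0.
rewrite lin_iterS; apply: supp_in_lin IHj => [|b' b'E]; first exact: supp_in_submod.
by apply: supp_in_sub (@bd_deg b') => b'' ->; lia.
Qed.

Lemma susp_bd_deg p :
  supp_in (fun p' => susp_deg p' = susp_deg p + 1) (susp_bd (delta R p)).
Proof.
case: p => b i; rewrite fs_lift_delta /= /susp_map; case: ifP => [i_n|/negbT i_n].
  rewrite fs_lift_delta; apply: supp_in_delta.
  by rewrite /susp_deg /= inordK //; lia.
rewrite susp_lastE; apply: (submodN (supp_in_submod _)).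
apply: (submod_sum (supp_in_submod _)) => j _.
apply: (supp_in_lin (f := susp_incl (n - j)) (supp_in_submod _) _ (@bd_iter_deg j.+1 b)) => b' b'E.
rewrite fs_lift_delta; apply: supp_in_delta.
have := ltn_ord i; have := ltn_ord j.
by rewrite /susp_deg /= inordK ?ltnS ?leq_subr // b'E; lia.
Qed.

(** * Homotopies from splittings of extensions of the suspension *)

Variables (E : lmodType R) (d : {linear E -> E}) (W : int -> E -> Prop).
Hypothesis W_submod : forall i, is_submod (W i).
Hypothesis ext_susp : ext_vanish N d W SB.
Variable f : {linear fsmod R B -> E}.
Hypothesis f_W : forall b, W (deg b) (f (delta R b)).
Hypothesis f_bd : forall x, d (f x) = f (bd x).

(** The extension class attached to the chain map [f]: copy n of [b] has degree deg b - 1, so [f]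
    raises the degree by one there. *)
Let u : {linear fsmod R SB -> E} :=
  fs_lift (fun p : SB => if p.2 == n :> nat then f (delta R p.1) else 0).

Let u_incl k x : (k <= n)%N -> u (susp_incl k x) = if k == n then f x else 0.
Proof.
move=> kn; pose g : {linear fsmod R B -> E} := if k == n then f else 0.
have -> : (if k == n then f x else 0) = g x by rewrite /g; case: ifP.
move: x; apply: (@fs_lin_eq _ _ _ (lin_comp u (susp_incl k))) => b.
rewrite -[LHS]/(u (susp_incl k (delta R b))) !fs_lift_delta /= inordK //.
by rewrite /g; case: ifP.
Qed.

Let u_last x : u (susp_last x) = - f (bd x).
Proof.
rewrite susp_lastE linearN linear_sum big_ord_recl big1 => [|j _] /=.
  by rewrite subn0 u_incl // eqxx addr0.
rewrite /bump leq0n add1n u_incl ?leq_subr // ifF //; have := ltn_ord j; lia.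
Qed.

(** The value f x appears once the iterates reach copy n, after n + 1 - k steps. The next step adds
    - f (bd x) to d (f x), which gives 0 because [f] is a chain map. In particular the sum vanishes
    for m = N. *)
Let u_cocycle m k x : (k <= n)%N ->
  cocycle d susp_bd u m (susp_incl k x) = if (m + k)%N == n.+1 then f x else 0.
Proof.
move=> kn; elim: m => [|m IHm]; first by rewrite add0n ifF //; lia.
rewrite cocycleS IHm.
have -> : susp_incl k x = lin_iter susp_bd k (susp_incl 0 x).
  by rewrite susp_bd_iter 1?ltnW // /susp_map kn.
rewrite -lin_iterD addSn eqSS.
have [mk|mk] := leqP (m + k) n.+1; last first.
  rewrite -(subnK mk) susp_bdN0 !linear0 ?addr0.
  by rewrite !ifF ?linear0 ?addr0 //; lia.
rewrite susp_bd_iter // /susp_map.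
have [mkn|mkn] := leqP (m + k) n.
  by rewrite ifF ?linear0 ?add0r ?u_incl //; lia.
have -> : (m + k)%N = n.+1 by lia.
by rewrite eqxx u_last f_bd subrr ifF //; lia.
Qed.

(** The homotopy is the splitting restricted to copy 0. On the copies below n the splitting equation
    determines [w] from copy 0; on copy n it becomes the homotopy formula. *)
Lemma susp_null_homotopic : exists s : {linear fsmod R B -> E},
  (forall b, W (deg b - N%:Z + 1) (s (delta R b))) /\
  (forall x, f x = \sum_(j < N) lin_iter d (N.-1 - j) (s (lin_iter bd j x))).
Proof.
have uW p : W (susp_deg p + 1) (u (delta R p)).
  case: p => b i; rewrite fs_lift_delta /=; case: eqP => [iE|_]; last exact: submod0.
  by rewrite /susp_deg /= iE (_ : _ + 1 = deg b) //; lia.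
have [|w [wW wE]] := ext_susp susp_bd_deg susp_bdN uW.
  apply: (@fs_lin_eq _ _ _ _ 0) => -[b i].
  rewrite susp_incl_delta u_cocycle ?ifF //; first lia.
  by rewrite -ltnS ltn_ord.
have wincl k x : (k <= n)%N -> w (susp_incl k x) = lin_iter d k (w (susp_incl 0 x)).
  elim: k => [//|k IHk] kn; rewrite lin_iterS -IHk 1?ltnW //.
  have := wE (susp_incl k x); rewrite susp_bd_incl 1?ltnW // /susp_map kn.
  rewrite u_incl 1?ltnW // ltn_eqF // => /eqP.
  by rewrite subr_eq0 => /eqP.
exists (lin_comp w (susp_incl 0)); split=> [b|x].
  have := wW ((b, ord0) : SB); rewrite susp_incl_delta /susp_deg /= addr0.
  exact.
have := wE (susp_incl n x).
rewrite susp_bd_incl // /susp_map ltnn susp_lastE u_incl // eqxx => <-.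
rewrite linearN opprK linear_sum wincl // -lin_iterS [RHS]big_ord_recl subn0.
congr (_ + _); apply: eq_bigr => j _.
by rewrite wincl ?leq_subr // lift0 subSS.
Qed.

End Suspension.

(** * Cells *)

Section ModuleComplex.
Variables (R : pzRingType) (N : nat) (Pr : Mod R -> Prop).
Variable X : Ncomplex N (full_sub Pr).

Definition cxmod (i : int) : lmodType R := sval (X i).

Definition cxd (i : int) : {linear cxmod i -> cxmod (i + 1)} := diff X i.

Definition cxdn (r : nat) (i : int) : {linear cxmod i -> cxmod (i + r%:Z)} :=
  diter (diff X) r i.

Definition cxcast (i j : int) (e : i = j) : {linear cxmod i -> cxmod j} :=
  castm X e.

Lemma cxdnS r i x :
  cxdn r.+1 i x = cxcast (idxS i r) (cxd (i + r%:Z) (cxdn r i x)).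
Proof. by []. Qed.

Lemma cxdnN i x : cxdn N i x = 0.
Proof. by rewrite /cxdn diffN0. Qed.

Lemma cxcast_id i (e : i = i) x : cxcast e x = x.
Proof. by rewrite (Prop_irrelevance e erefl). Qed.

(** Equality of degrees is decided inside the map, so that maps out of an ungraded free module can
    be given on each basis element without casts. *)
Definition cxproj (i j : int) : {linear cxmod i -> cxmod j} :=
  if pselect (i = j) is left e then cxcast e else 0.

Lemma cxproj_id i x : cxproj i i x = x.
Proof. by rewrite /cxproj; case: pselect => // e; apply: cxcast_id. Qed.

Lemma cxproj_neq i j x : i <> j -> cxproj i j x = 0.
Proof. by rewrite /cxproj; case: pselect. Qed.

Lemma cxproj_cast i k j (e : i = k) x : cxproj k j (cxcast e x) = cxproj i j x.
Proof. by case: k / e. Qed.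

Lemma cxproj_d i j x : cxproj (i + 1) (j + 1) (cxd i x) = cxd j (cxproj i j x).
Proof.
have [ij|ij] := EM (i = j); first by case: j / ij; rewrite !cxproj_id.
rewrite !cxproj_neq ?linear0 // => /addIr.
exact: ij.
Qed.

Lemma fam_cxcast (V : Type) (f : forall k, cxmod k -> V) i j (e : i = j) x :
  f j (cxcast e x) = f i x.
Proof. by case: j / e. Qed.

(** Evaluating a family defined in all degrees absorbs the casts. The family [f] is generalized so
    that the induction can absorb a differential into it. *)
Lemma fam_cxdnSr (V : Type) (f : forall k, cxmod k -> V) r i x :
  f (i + 1 + r%:Z) (cxdn r (i + 1) (cxd i x)) = f (i + r.+1%:Z) (cxdn r.+1 i x).
Proof.
elim: r f => [|r IHr] f; rewrite cxdnS !fam_cxcast.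
  exact/esym/(@fam_cxcast _ (fun k y => f (k + 1) (cxd k y))).
exact: (IHr (fun k y => f (k + 1) (cxd k y))).
Qed.

End ModuleComplex.

Section Cells.
Variables (R : pzRingType) (N : nat) (Pr : Mod R -> Prop).
Variable Y : Ncomplex N (full_sub Pr).
Hypothesis N_gt0 : (0 < N)%N.

(* Basis of the coreflection: [base i y k] is the k-th vector of a disk mapping
   its bottom generator to y in Y^i, and [attach deg bd u b] is the value at b
   of a splitting of the extension given by [bd] and [u]. The values of [u] are
   combinations of cells themselves, so that the inductive type takes the place
   of a transfinite iteration. *)
Inductive cell :=
| base (i : int) (y : cxmod Y i) (k : nat)
| attach (deg : nat -> int) (bd : {linear fsmod R nat -> fsmod R nat})
    (u : nat -> seq (R * cell)) (b : nat).

HB.instance Definition _ := gen_eqMixin cell.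

Definition cell_deg (c : cell) : int :=
  match c with
  | base i _ k => i + k%:Z
  | attach deg _ _ b => deg b
  end.

(** The cells store lists because [fsmod R cell] would contain [cell] in a negative position.
    Repetitions and zero coefficients in a list are harmless, since only its sum matters. *)
Definition comb (s : seq (R * cell)) : fsmod R cell :=
  \sum_(rc <- s) rc.1 *: delta R rc.2.

Definition cell_d : {linear fsmod R cell -> fsmod R cell} :=
  fs_lift (fun c : cell => match c with
  | base i y k => if (k.+1 < N)%N then delta R (base y k.+1) else 0
  | attach deg bd u b =>
      fs_lift (fun b' => delta R (attach deg bd u b')) (bd (delta R b)) + comb (u b)
  end).

Definition cell_pi (l : int) : {linear fsmod R cell -> cxmod Y l} :=
  fs_lift (fun c : cell => match c with
  | base i y k => cxproj Y (i + k%:Z) l (cxdn Y k i y)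
  | attach _ _ _ _ => 0
  end).

(** For attached cells these are the hypotheses of [ext_vanish] for [ker_pi]. They are imposed
    afterwards because they mention [cell_d] and [cell_pi], which are defined on raw cells. *)
Inductive wf_cell : cell -> Prop :=
| wf_base i (y : cxmod Y i) k : (k < N)%N -> wf_cell (base y k)
| wf_attach (deg : nat -> int) (bd : {linear fsmod R nat -> fsmod R nat})
      (u : nat -> seq (R * cell)) (b : nat) :
    (forall a, supp_in (fun a' => deg a' = deg a + 1) (bd (delta R a))) ->
    (forall x, lin_iter bd N x = 0) ->
    (forall a c, comb (u a) c <> 0 -> wf_cell c) ->
    (forall a c, comb (u a) c <> 0 -> cell_deg c = deg a + 1) ->
    (forall a l, cell_pi l (comb (u a)) = 0) ->
    (forall x, cocycle cell_d bd (fs_lift (fun a => comb (u a))) N x = 0) ->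
    wf_cell (attach deg bd u b).

Definition good (i : int) (c : cell) := wf_cell c /\ cell_deg c = i.

Definition ker_pi (i : int) (x : fsmod R cell) :=
  supp_in (good i) x /\ forall l, cell_pi l x = 0.

Lemma comb_surj (x : fsmod R cell) : exists s, comb s = x.
Proof.
exists [seq (x c : R, c) | c <- fs_supp x].
by rewrite /comb big_map [RHS]fs_expand.
Qed.

Lemma ker_pi_submod i : is_submod (ker_pi i).
Proof.
split=> [|r x y [xi x0] [yi y0]].
  by split=> [|l]; [apply: submod0 (supp_in_submod _) | apply: linear0].
split=> [|l]; first exact: (submodZD (supp_in_submod _)).
by rewrite linearP x0 y0 scaler0 addr0.
Qed.

Lemma cell_d_good i x : supp_in (good i) x -> supp_in (good (i + 1)) (cell_d x).
Proof.
apply: (supp_in_lin (supp_in_submod _)) => c [wc <-]; rewrite fs_lift_delta.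
case: wc => [j y k kN|deg bd u b bdd bdN uw ud upi ucc].
  case: ifP => [k1N|_]; last exact: submod0 (supp_in_submod _).
  by apply: supp_in_delta; split; [constructor | rewrite /= idxS].
apply: (submodD (supp_in_submod _)).
  apply: (supp_in_lin (supp_in_submod _)) (bdd b) => a ad.
  rewrite fs_lift_delta; apply: supp_in_delta; split=> //=.
  exact: wf_attach.
move=> c' nc; apply: contra_notP nc => uc.
by split; [apply: uw uc | apply: ud uc].
Qed.

Lemma cell_d_iter_base i y k m :
  lin_iter cell_d m (delta R (@base i y k)) =
  if (m == 0)%N || (k + m < N)%N then delta R (base y (k + m)) else 0.
Proof.
elim: m => [|m IHm]; first by rewrite addn0.
rewrite lin_iterS IHm /=.
case: ifP => [_|/norP]; last first.
  rewrite linear0 -leqNgt => -[_ Nkm].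
  by rewrite ifF // addnS; apply/negbTE; rewrite -leqNgt leqW.
by rewrite fs_lift_delta addnS.
Qed.

(** A disk has N generators. For attached cells, the map [w] sending [a] to the cell at [a]
    satisfies d w - w bd = u by construction, so d^N w equals the cocycle sum of [u] plus w bd^N,
    and both vanish. *)
Lemma cell_dN i x : supp_in (good i) x -> lin_iter cell_d N x = 0.
Proof.
apply: (supp_in_lin_eq (g := 0)) => c [wc _].
case: wc => [j y k kN|deg bd u b bdd bdN uw ud upi ucc].
  rewrite cell_d_iter_base -[(N == 0)%N]negbK -lt0n N_gt0 /=.
  by rewrite ltnNge leq_addl.
pose w : {linear fsmod R nat -> fsmod R cell} :=
  fs_lift (fun a => delta R (attach deg bd u a)).
have -> : delta R (attach deg bd u b) = w (delta R b) by rewrite fs_lift_delta.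
have wE x' : fs_lift (fun a => comb (u a)) x' = cell_d (w x') - w (bd x').
  pose g : {linear fsmod R nat -> fsmod R cell} := lin_comp cell_d w - lin_comp w bd.
  apply: (@fs_lin_eq _ _ _ _ g) => a.
  rewrite -[g _]/(cell_d (w (delta R a)) - w (bd (delta R a))).
  by rewrite !fs_lift_delta addrC addKr.
have := cocycle_boundary wE N (delta R b).
by rewrite ucc bdN linear0 subr0 => <-.
Qed.

(** At the end of a disk both sides vanish because d^N = 0 in [Y]. On attached cells they vanish
    because the projection kills these cells and the values of [u]. *)
Lemma cell_pi_d i l x :
  supp_in (good i) x -> cell_pi (l + 1) (cell_d x) = cxd Y l (cell_pi l x).
Proof.
apply: (supp_in_lin_eq (f := lin_comp (cell_pi (l + 1)) cell_d)
  (g := lin_comp (cxd Y l) (cell_pi l))) => c [wc _].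
rewrite -[LHS]/(cell_pi (l + 1) (cell_d (delta R c))).
rewrite -[RHS]/(cxd Y l (cell_pi l (delta R c))).
case: wc => [j y k kN|deg bd u b bdd bdN uw ud upi ucc].
  rewrite !fs_lift_delta -cxproj_d.
  have := cxproj_cast (X := Y) (l + 1) (idxS j k) (cxd Y _ (cxdn Y k j y)).
  rewrite -cxdnS => <-; case: ifP => k1N; first by rewrite fs_lift_delta.
  have {k1N} -> : k.+1 = N by apply/eqP; rewrite eqn_leq kN leqNgt k1N.
  by rewrite cxdnN !linear0.
rewrite !fs_lift_delta !linear0 linearD upi addr0.
move: (bd _); apply: (@fs_lin_eq _ _ _ (lin_comp (cell_pi (l + 1)) _) 0) => a.
by rewrite /= !fs_lift_delta.
Qed.

Lemma ker_pi_d i x : ker_pi i x -> ker_pi (i + 1) (cell_d x).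
Proof.
move=> [xi x0]; split=> [|l]; first exact: cell_d_good.
by rewrite -[l](subrK 1) (cell_pi_d _ xi) x0 linear0.
Qed.

Lemma ker_pi_dN i x : ker_pi i x -> lin_iter cell_d N x = 0.
Proof. by move=> [+ _]; apply: cell_dN. Qed.

(** The cells attached for the given extension split it: the definition of [cell_d] on them is the
    splitting equation. *)
Lemma cell_ext_nat : ext_vanish N cell_d ker_pi nat.
Proof.
move=> deg bd v bdd bdN vW vcc.
have /choice[u uE] : forall a, exists s, comb s = v (delta R a).
  by move=> a; apply: comb_surj.
have vE x : fs_lift (fun a => comb (u a)) x = v x.
  by move: x; apply: fs_lin_eq => a; rewrite fs_lift_delta.
have vE' : fs_lift (fun a => comb (u a)) = v by apply: linearP_eq.
have uW a c : comb (u a) c <> 0 -> good (deg a + 1) c.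
  by rewrite uE => uc; apply: contra_notP uc; apply: (vW a).1.
have wfa b : wf_cell (attach deg bd u b).
  constructor=> // [a c /uW[]|a c /uW[]|a l|x] //; last by rewrite vE'.
  by rewrite uE; case: (vW a).
exists (fs_lift (fun a => delta R (attach deg bd u a))); split=> [b|x].
  rewrite fs_lift_delta; split=> [|l]; last by rewrite fs_lift_delta.
  exact: supp_in_delta.
rewrite -vE; set w := fs_lift _.
pose g : {linear fsmod R nat -> fsmod R cell} := lin_comp cell_d w - lin_comp w bd.
move: x; apply: (@fs_lin_eq _ _ _ g) => a.
rewrite -[g _]/(cell_d (w (delta R a)) - w (bd (delta R a))).
by rewrite !fs_lift_delta addrC addKr.
Qed.

Lemma cell_ext (B : eqType) : ext_vanish N cell_d ker_pi B.
Proof.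
apply: ext_vanish_any cell_ext_nat => //.
- exact: ker_pi_submod.
- exact: ker_pi_d.
- exact: ker_pi_dN.
Qed.

End Cells.

(** * Complexes of projectives *)

Section ProjectiveSource.
Variables (R : pzRingType) (n : nat).
Local Notation N := n.+2.
Variable Q : Ncomplex N (Prj R).
Local Notation M := (cxmod Q).

(** Every element of every term is a basis vector, which makes the projections [total_proj] onto the
    terms surjective. *)
Definition total_basis : eqType := {i : int & M i}.

Definition total_proj (j : int) : {linear fsmod R total_basis -> M j} :=
  fs_lift (fun b : total_basis => cxproj Q (tag b) j (tagged b)).

Lemma total_proj_delta i j (x : M i) :
  total_proj j (delta R (Tagged M x : total_basis)) = cxproj Q i j x.
Proof. exact: fs_lift_delta. Qed.

(** It cuts a section given by projectivity down to basis vectors of its own degree. *)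
Definition total_trunc (i : int) :
    {linear fsmod R total_basis -> fsmod R total_basis} :=
  fs_lift (fun b : total_basis => if tag b == i then delta R b else 0).

Lemma total_trunc_supp i x :
  supp_in (fun b : total_basis => tag b = i) (total_trunc i x).
Proof.
move: x; apply: fs_ind => [|b]; first exact/submod_preim/supp_in_submod.
rewrite fs_lift_delta; case: eqP => [bi|_]; first exact: supp_in_delta.
exact: submod0 (supp_in_submod _).
Qed.

Lemma total_proj_trunc i x : total_proj i (total_trunc i x) = total_proj i x.
Proof.
move: x; apply: (@fs_lin_eq _ _ _ (lin_comp _ _)) => -[j y] /=.
rewrite fs_lift_delta /=; case: eqP => // ji.
by rewrite total_proj_delta cxproj_neq // linear0.
Qed.

Lemma total_section_ex i :
  exists h : {linear M i -> fsmod R total_basis},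
    (forall x, total_proj i (h x) = x) /\
    (forall x, supp_in (fun b : total_basis => tag b = i) (h x)).
Proof.
have projM : projective (M i) := svalP (Q i).
have [|h hE] := projM _ _ (total_proj i) (lin_id (M i)).
  by move=> x; exists (delta R (Tagged M x : total_basis)); rewrite total_proj_delta cxproj_id.
exists (lin_comp (total_trunc i) h); split=> x; last exact: total_trunc_supp.
by rewrite /= total_proj_trunc hE.
Qed.

Definition total_section i : {linear M i -> fsmod R total_basis} :=
  projT1 (cid (total_section_ex i)).

Lemma total_sectionK i x : total_proj i (total_section i x) = x.
Proof. exact: (projT2 (cid (total_section_ex i))).1. Qed.

Lemma total_section_supp i x :
  supp_in (fun b : total_basis => tag b = i) (total_section i x).
Proof. exact: (projT2 (cid (total_section_ex i))).2. Qed.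

Lemma total_section_cast i j (e : i = j) x :
  total_section j (cxcast Q e x) = total_section i x.
Proof. by case: j / e. Qed.

(* [Q] is a direct summand of the complex of free modules with differential
   h d p, where p is the projection onto [Q] and h a section of it. *)
Definition total_bd : {linear fsmod R total_basis -> fsmod R total_basis} :=
  fs_lift (fun b : total_basis => total_section (tag b + 1) (cxd Q (tag b) (tagged b))).

Lemma total_bdE i x : supp_in (fun b : total_basis => tag b = i) x ->
  total_bd x = total_section (i + 1) (cxd Q i (total_proj i x)).
Proof.
apply: (supp_in_lin_eq
  (g := lin_comp (total_section (i + 1)) (lin_comp (cxd Q i) (total_proj i)))).
move=> -[j y] /= ji; case: i / ji.
by rewrite fs_lift_delta /= total_proj_delta cxproj_id.
Qed.

Lemma total_bd_section i x :
  total_bd (total_section i x) = total_section (i + 1) (cxd Q i x).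
Proof. by rewrite (total_bdE (@total_section_supp i x)) total_sectionK. Qed.

Lemma total_bd_deg (b : total_basis) :
  supp_in (fun b' : total_basis => tag b' = tag b + 1) (total_bd (delta R b)).
Proof. by rewrite fs_lift_delta; apply: total_section_supp. Qed.

Lemma total_bd_iter r i x :
  lin_iter total_bd r (total_section i x) = total_section (i + r%:Z) (cxdn Q r i x).
Proof.
elim: r => [|r IHr]; first by rewrite [RHS]total_section_cast.
by rewrite lin_iterS IHr total_bd_section cxdnS total_section_cast.
Qed.

(** The first differential sees a basis vector b only through h p b, and on the image of h the
    iterate bd^r is h d^r. *)
Lemma total_bdN x : lin_iter total_bd N x = 0.
Proof.
move: x; apply: (@fs_lin_eq _ _ _ _ 0) => b.
have bb : supp_in (fun b' : total_basis => tag b' = tag b) (delta R b).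
  exact: supp_in_delta.
rewrite lin_iterSr (total_bdE bb) -total_bd_section -lin_iterSr total_bd_iter.
by rewrite cxdnN linear0.
Qed.

Section Target.
Variables (E : lmodType R) (d : {linear E -> E}) (W : int -> E -> Prop).
Hypothesis W_submod : forall i, is_submod (W i).
Hypothesis ext_W : forall B : eqType, ext_vanish N d W B.

Section Total.
Variable f : forall i, {linear M i -> E}.

Definition total_map : {linear fsmod R total_basis -> E} :=
  fs_lift (fun b : total_basis => f (tag b) (tagged b)).

Lemma total_mapE i x : supp_in (fun b : total_basis => tag b = i) x ->
  total_map x = f i (total_proj i x).
Proof.
apply: (supp_in_lin_eq (g := lin_comp (f i) (total_proj i))) => -[j y] /= ji.
by case: i / ji; rewrite fs_lift_delta /= total_proj_delta cxproj_id.
Qed.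

Lemma total_map_section i x : total_map (total_section i x) = f i x.
Proof. by rewrite (total_mapE (@total_section_supp i x)) total_sectionK. Qed.

Lemma total_map_bd (b : total_basis) :
  total_map (total_bd (delta R b)) = f (tag b + 1) (cxd Q (tag b) (tagged b)).
Proof. by rewrite fs_lift_delta total_map_section. Qed.

End Total.

(** The failure of [f] to commute with d is an extension of the total complex by [W]. A splitting,
    restricted along the sections, gives a [w] with values in [W] and the same failure, so that f -
    w is a chain map. *)
Lemma projective_correction (f : forall i, {linear M i -> E}) :
  (forall i x, lin_iter d N (f i x) = 0) ->
  (forall i x, W (i + 1) (d (f i x) - f (i + 1) (cxd Q i x))) ->
  exists w : forall i, {linear M i -> E},
    (forall i x, W i (w i x)) /\
    (forall i x, d (w i x) - w (i + 1) (cxd Q i x) = d (f i x) - f (i + 1) (cxd Q i x)).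
Proof.
move=> f_dN fW; pose F := total_map f.
pose u : {linear fsmod R total_basis -> E} := lin_comp d F - lin_comp F total_bd.
have uE x : u x = d (F x) - F (total_bd x) by [].
have uW b : W (tag b + 1) (u (delta R b)).
  by rewrite uE [F _]fs_lift_delta total_map_bd; apply: fW.
have ucc x : cocycle d total_bd u N x = 0.
  rewrite (cocycle_boundary uE) total_bdN linear0 subr0.
  move: x; apply: (@fs_lin_eq _ _ _ (lin_comp (lin_iter d N) F) 0) => b.
  by rewrite -[LHS]/(lin_iter d N (F (delta R b))) fs_lift_delta f_dN.
have [w [wW wE]] := ext_W total_bd_deg total_bdN uW ucc.
exists (fun i => lin_comp w (total_section i)); split=> i x.
  apply: (supp_in_lin (f := w) (W_submod i) _ (@total_section_supp i x)) => b <-.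
  exact: wW.
rewrite -[lin_comp w (total_section i) x]/(w (total_section i x)).
rewrite -[lin_comp w _ (cxd Q i x)]/(w (total_section (i + 1) (cxd Q i x))).
rewrite -total_bd_section wE uE total_bd_section.
by rewrite /F !total_map_section.
Qed.

(** The chain map f p on the total complex is null-homotopic by the suspension argument; its
    homotopy restricts along the sections since bd^j h = h d^j. *)
Lemma projective_null_homotopic (f : forall i, {linear M i -> E}) :
  (forall i x, W i (f i x)) -> (forall i x, d (f i x) = f (i + 1) (cxd Q i x)) ->
  exists s : forall i, {linear M i -> E},
    (forall i x, W (i - N%:Z + 1) (s i x)) /\
    (forall i x, f i x =
       \sum_(j < N) lin_iter d (N.-1 - j) (s (i + j%:Z) (cxdn Q j i x))).
Proof.
move=> fW fd; pose F := total_map f.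
have FW b : W (tag b) (F (delta R b)) by rewrite fs_lift_delta; apply: fW.
have Fbd x : d (F x) = F (total_bd x).
  move: x; apply: (@fs_lin_eq _ _ _ (lin_comp d F) (lin_comp F total_bd)) => b.
  rewrite -[LHS]/(d (F (delta R b))) -[RHS]/(F (total_bd (delta R b))).
  by rewrite total_map_bd fs_lift_delta fd.
have [s [sW sE]] := susp_null_homotopic total_bd_deg total_bdN W_submod
  (@ext_W _) FW Fbd.
exists (fun i => lin_comp s (total_section i)); split=> i x.
  apply: (supp_in_lin (f := s) (W_submod _) _ (@total_section_supp i x)) => b <-.
  exact: sW.
rewrite -total_map_section sE; apply: eq_bigr => j _.
by rewrite total_bd_iter.
Qed.

End Target.
End ProjectiveSource.

(** * Free modules on a subset of a basis *)

Section SupportedSubmodule.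
Variables (R : pzRingType) (K : eqType) (S : K -> Prop).

Definition fssub_pred : {pred fsmod R K} := fun x => `[< supp_in S x >].

Lemma fssub_pred_closed : submod_closed fssub_pred.
Proof.
split=> [|r x y /asboolP Sx /asboolP Sy]; apply/asboolP.
  exact: submod0 (supp_in_submod S).
exact: submodZD (supp_in_submod S) _ _ _ Sx Sy.
Qed.

HB.instance Definition _ :=
  GRing.isSubmodClosed.Build R (fsmod R K) fssub_pred fssub_pred_closed.

Record fssub := FsSub { fssub_val : fsmod R K; _ : fssub_val \in fssub_pred }.

HB.instance Definition _ := [isSub for fssub_val].
HB.instance Definition _ := [Choice of fssub by <:].
HB.instance Definition _ := [SubChoice_isSubLmodule of fssub by <:].

Lemma fssub_val_linear : linear fssub_val.
Proof. by []. Qed.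

Definition fssub_incl : {linear fssub -> fsmod R K} := lin_of fssub_val_linear.

Lemma fssub_incl_inj x y : fssub_incl x = fssub_incl y -> x = y.
Proof. exact: val_inj. Qed.

Lemma fssub_supp x : supp_in S (fssub_incl x).
Proof. by case: x => x xS /=; apply/asboolP. Qed.

Lemma fssub_of (x : fsmod R K) : supp_in S x -> {y : fssub | fssub_incl y = x}.
Proof. by move=> Sx; exists (FsSub (asboolT Sx : x \in fssub_pred)). Qed.

Lemma fssub_factor (M : lmodType R) (f : {linear M -> fsmod R K}) :
  (forall x, supp_in S (f x)) ->
  {g : {linear M -> fssub} | forall x, fssub_incl (g x) = f x}.
Proof.
move=> fS; pose g x := sval (fssub_of (fS x)).
have gE x : fssub_incl (g x) = f x := svalP (fssub_of (fS x)).
have gL : linear g.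
  by move=> r x y; apply: fssub_incl_inj; rewrite linearP !gE linearP.
by exists (lin_of gL).
Qed.

Lemma fssub_projective : projective fssub.
Proof.
move=> A B g f gsurj.
have /choice[a aE] : forall k, exists a,
    forall y : fssub, S k -> fssub_incl y = delta R k -> g a = f y.
  move=> k; have [Sk|nSk] := EM (S k); last by exists 0.
  have [y yE] := fssub_of (supp_in_delta Sk : supp_in S (delta R k)).
  have [a aE] := gsurj (f y); exists a => z _ zE.
  by rewrite aE; congr (f _); apply: fssub_incl_inj; rewrite yE zE.
exists (lin_comp (fs_lift a) fssub_incl) => x.
(* [f] is defined only on the submodule, so the induction over the support carries along a preimage
   of [z]. *)
pose V z := exists2 y : fssub, fssub_incl y = z & g (fs_lift a z) = f y.
have [||y yx] := supp_in_ind (V := V) _ _ (fssub_supp x).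
- split=> [|r z1 z2 [y1 y1z g1] [y2 y2z g2]].
    by exists 0; rewrite ?linear0.
  by exists (r *: y1 + y2); rewrite !linearP ?y1z ?y2z ?g1 ?g2.
- move=> k Sk; have [y yE] := fssub_of (supp_in_delta Sk : supp_in S (delta R k)).
  by exists y => //; rewrite fs_lift_delta; apply: aE.
by rewrite (fssub_incl_inj yx).
Qed.

End SupportedSubmodule.

(** * The coreflection *)

Lemma homotopy_sum_compl N (C : preadditive) (X Y Z : Ncomplex N C)
    (g : chain_map Y Z) (s : forall i : int, phom (X i) (Y (i - N%:Z + 1))) i :
  g i \oc homotopy_sum s i = homotopy_sum (fun i => g _ \oc s i) i.
Proof.
rewrite pcomp_sumr; apply: eq_bigr => j _.
by rewrite !pcompA castm_nat -!pcompA; congr (_ \oc _);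
   rewrite !pcompA diter_nat -!pcompA; congr (_ \oc _);
   rewrite !pcompA castm_nat.
Qed.

Lemma homotopy_sum_amap N (C D : preadditive) (F : additive_functor C D)
    (X Y : Ncomplex N C) (s : forall i : int, phom (X i) (Y (i - N%:Z + 1))) i :
  amap F (homotopy_sum s i) =
  @homotopy_sum N D (KN_obj F X) (KN_obj F Y) (fun i : int => amap F (s i)) i.
Proof.
rewrite (big_morph _ (@amap_add _ _ F _ _) (@amap0 _ _ F _ _)).
by apply: eq_bigr => j _; rewrite !amapM !amap_castm !amap_diter.
Qed.

Lemma chain_subP N (C : preadditive) (X Y : Ncomplex N C) (f g : chain_map X Y) i :
  (f (i + 1) - g (i + 1)) \oc diff X i = diff Y i \oc (f i - g i).
Proof. by rewrite pcompDl pcompNl pcompDr pcompNr !cmapP. Qed.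

Definition chain_sub N (C : preadditive) (X Y : Ncomplex N C) (f g : chain_map X Y) :
  chain_map X Y := ChainMap (chain_subP f g).

Section Coreflection.
Variables (R : pzRingType) (n : nat).
Local Notation N := n.+2.
Variable Y : Ncomplex N (Flat R).
Local Notation E := (fsmod R (cell Y)).
Local Notation d := (cell_d Y).
Local Notation W := (@ker_pi _ _ _ Y).

Definition cofree_mod (i : int) : lmodType R := fssub R (@good _ _ _ Y i).

Definition cofree_obj (i : int) : Prj R :=
  exist _ (cofree_mod i : Mod R) (@fssub_projective R _ (@good _ _ _ Y i)).

Definition cofree_incl (i : int) : {linear cofree_mod i -> E} :=
  fssub_incl R (@good _ _ _ Y i).

Lemma cofree_diff_subproof i (x : cofree_mod i) :
  supp_in (@good _ _ _ Y (i + 1)) (lin_comp d (cofree_incl i) x).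
Proof. by apply: cell_d_good; apply: fssub_supp. Qed.

Definition cofree_diff i : {linear cofree_mod i -> cofree_mod (i + 1)} :=
  sval (fssub_factor (@cofree_diff_subproof i)).

Lemma cofree_diffE i x : cofree_incl (i + 1) (cofree_diff i x) = d (cofree_incl i x).
Proof. exact: svalP (fssub_factor (@cofree_diff_subproof i)) x. Qed.

Lemma cofree_castm i j (e : i = j) (x : cofree_mod i) :
  cofree_incl j ((castm cofree_obj e : {linear cofree_mod i -> cofree_mod j}) x) =
  cofree_incl i x.
Proof. by case: j / e. Qed.

Lemma cofree_diter r i (x : cofree_mod i) :
  cofree_incl (i + r%:Z) ((@diter (Prj R) cofree_obj cofree_diff r i
    : {linear cofree_mod i -> cofree_mod (i + r%:Z)}) x) =
  lin_iter d r (cofree_incl i x).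
Proof.
elim: r => [|r IHr]; first exact: cofree_castm.
by rewrite [LHS]cofree_castm cofree_diffE IHr.
Qed.

Lemma cofree_diffN0 i : @diter (Prj R) cofree_obj cofree_diff N i = 0.
Proof.
apply: linearP_eq => x; apply: fssub_incl_inj.
rewrite [LHS]cofree_diter; apply: cell_dN => //.
exact: fssub_supp.
Qed.

Definition cofree : Ncomplex N (Prj R) := NComplex cofree_diffN0.

Lemma cofree_homotopy_sum (Q : Ncomplex N (Prj R))
    (s : forall i : int, phom (Q i) (cofree (i - N%:Z + 1))) i (x : cxmod Q i) :
  cofree_incl i ((homotopy_sum s i : {linear cxmod Q i -> cofree_mod i}) x) =
  \sum_(j < N) lin_iter d (N.-1 - j)
    (cofree_incl _ ((s (i + j%:Z) : {linear _ -> cofree_mod _}) (cxdn Q j i x))).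
Proof.
pose ev (f : phom (Q i) (cofree i)) : E :=
  cofree_incl i ((f : {linear cxmod Q i -> cofree_mod i}) x).
have evD : {morph ev : f g / f + g} by [].
rewrite -[LHS]/(ev (homotopy_sum s i)) (big_morph ev evD erefl).
apply: eq_bigr => j _; rewrite /ev.
by rewrite [LHS]cofree_castm [LHS]cofree_diter [X in lin_iter _ _ X]cofree_castm.
Qed.

(** Every homotopy sum is a chain map: the two sums agree after a shift of the index, and the extra
    terms d^N s and s d^N vanish. *)
Lemma cofree_homotopy_sum_d (Q : Ncomplex N (Prj R))
    (s : forall i : int, phom (Q i) (cofree (i - N%:Z + 1))) i (x : cxmod Q i) :
  d (cofree_incl i ((homotopy_sum s i : {linear cxmod Q i -> cofree_mod i}) x)) =
  cofree_incl (i + 1) ((homotopy_sum s (i + 1)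
    : {linear cxmod Q (i + 1) -> cofree_mod (i + 1)}) (cxd Q i x)).
Proof.
pose G k (y : cxmod Q k) : E :=
  cofree_incl _ ((s k : {linear cxmod Q k -> cofree_mod _}) y).
rewrite !cofree_homotopy_sum linear_sum.
rewrite [LHS](eq_bigr (fun j : 'I_N => lin_iter d (N - j) (G _ (cxdn Q j i x)))) => [|j _].
  rewrite [RHS](eq_bigr (fun j : 'I_N =>
      lin_iter d (N.-1 - j) (G _ (cxdn Q j.+1 i x)))) => [|j _]; last first.
    by congr (lin_iter _ _ _); apply: (@fam_cxdnSr _ _ _ _ _ G).
  rewrite [LHS]big_ord_recl [RHS]big_ord_recr.
  rewrite (@cell_dN _ _ _ Y _ _ _ (fssub_supp _)) // add0r -[LHS]addr0.
  apply: (congr2 +%R).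
    by apply: eq_bigr => j _; rewrite lift0 subSS.
  have GN : G (i + N%:Z) (cxdn Q N i x) = 0 by rewrite cxdnN /G !linear0.
  by rewrite [X in _ = lin_iter _ _ X]GN linear0.
by rewrite -lin_iterS -subSn // -ltnS.
Qed.

Definition counit_fun i : {linear cofree_mod i -> cxmod Y i} :=
  lin_comp (cell_pi Y i) (cofree_incl i).

Lemma counitP i :
  (counit_fun (i + 1) : phom (KN_obj (prj_flat_incl R) cofree (i + 1)) (Y (i + 1)))
    \oc diff (KN_obj (prj_flat_incl R) cofree) i =
  diff Y i \oc (counit_fun i : phom (KN_obj (prj_flat_incl R) cofree i) (Y i)).
Proof.
apply: linearP_eq => x.
rewrite -[LHS]/(cell_pi Y (i + 1) (cofree_incl (i + 1) (cofree_diff i x))).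
by rewrite cofree_diffE (cell_pi_d _ (@fssub_supp _ _ _ x)).
Qed.

Definition counit : chain_map (KN_obj (prj_flat_incl R) cofree) Y :=
  @ChainMap N (Flat R) (KN_obj (prj_flat_incl R) cofree) Y counit_fun counitP.

Lemma counit_surj i : surjective (counit_fun i).
Proof.
move=> y; have gy : @good _ _ _ Y i (@base _ _ _ Y i y 0).
  by split; [constructor | rewrite /= addr0].
have [x xE] := fssub_of (supp_in_delta gy : supp_in _ (delta R _)).
exists x; rewrite -[LHS]/(cell_pi Y i (cofree_incl i x)) [cofree_incl i x]xE.
rewrite fs_lift_delta -[cxdn Y 0 i y]/(cxcast Y (idx0 i) y).
by rewrite cxproj_cast cxproj_id.
Qed.

(** In degrees l other than i the projection vanishes on cells of degree i, so one equation yields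
    all those required by [ker_pi]. *)
Lemma counit_kernel i (x : cofree_mod i) : counit_fun i x = 0 -> W i (cofree_incl i x).
Proof.
move=> x0; split=> [|l]; first exact: fssub_supp.
have [<- //|il] := EM (i = l).
apply: (supp_in_lin_eq (g := 0) _ (@fssub_supp _ _ _ x)) => c [_ cl].
rewrite fs_lift_delta; case: c cl => //= j y k jk.
by rewrite cxproj_neq // jk.
Qed.

(** * Lifting chain maps and homotopies along the counit *)

Section Source.
Variable Q : Ncomplex N (Prj R).
Local Notation M := (cxmod Q).

Lemma counit_lift i j (g : {linear M i -> cxmod Y j}) :
  {f : {linear M i -> cofree_mod j} | forall x, counit_fun j (f x) = g x}.
Proof.
by apply: cid; apply: (svalP (Q i) _ _ (counit_fun j) g); apply: counit_surj.
Qed.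

Lemma cofree_factor i j (f : {linear M i -> E}) : (forall x, W j (f x)) ->
  {g : {linear M i -> cofree_mod j} | forall x, cofree_incl j (g x) = f x}.
Proof. by move=> fW; apply: fssub_factor => x; case: (fW x). Qed.

(** A degreewise lift [f0] exists because the terms of [Q] are projective and the counit is
    surjective. Its failure to commute with d lies in the kernel [W], so it can be corrected within
    [W], which leaves the composite with the counit unchanged. *)
Lemma chain_map_lift (g : chain_map (KN_obj (prj_flat_incl R) Q) Y) :
  exists f : chain_map Q cofree,
    chain_comp counit (chain_image (prj_flat_incl R) f) = g.
Proof.
pose gl i : {linear M i -> cxmod Y i} := g i.
have glP i x : gl (i + 1) (cxd Q i x) = cxd Y i (gl i x).
  exact: (congr1 (fun h : {linear M i -> cxmod Y (i + 1)} => h x) (cmapP g i)).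
pose f0 i := sval (counit_lift (gl i)).
have f0E i x : counit_fun i (f0 i x) = gl i x := svalP (counit_lift (gl i)) x.
have f0dN i x : lin_iter d N (lin_comp (cofree_incl i) (f0 i) x) = 0.
  by apply: cell_dN => //; apply: fssub_supp.
have f0W i x : W (i + 1) (d (lin_comp (cofree_incl i) (f0 i) x) -
    lin_comp (cofree_incl (i + 1)) (f0 (i + 1)) (cxd Q i x)).
  rewrite -[_ - _]/(d (cofree_incl i (f0 i x)) - cofree_incl (i + 1) (f0 (i + 1) (cxd Q i x))).
  rewrite -cofree_diffE -linearB; apply: counit_kernel.
  rewrite linearB f0E glP -f0E; apply/eqP; rewrite subr_eq0; apply/eqP.
  exact: (congr1 (fun h : {linear cofree_mod i -> cxmod Y (i + 1)} => h (f0 i x)) (cmapP counit i)).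
have [w [wW wE]] := projective_correction (@ker_pi_submod _ _ _ Y)
  (cell_ext (ltn0Sn _)) f0dN f0W.
pose w1 i := sval (cofree_factor (wW i)).
have w1E i x : cofree_incl i (w1 i x) = w i x := svalP (cofree_factor (wW i)) x.
pose f i : {linear M i -> cofree_mod i} := f0 i - w1 i.
have fE i x : cofree_incl i (f i x) = cofree_incl i (f0 i x) - w i x.
  by rewrite -w1E -linearB.
have fP i : (f (i + 1) : phom (Q (i + 1)) (cofree (i + 1))) \oc diff Q i =
    diff cofree i \oc (f i : phom (Q i) (cofree i)).
  apply: linearP_eq => x; apply: fssub_incl_inj.
  rewrite -[LHS]/(cofree_incl (i + 1) (f (i + 1) (cxd Q i x))).
  rewrite -[RHS]/(cofree_incl (i + 1) (cofree_diff i (f i x))).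
  rewrite cofree_diffE !fE linearB.
  have : d (cofree_incl i (f0 i x)) - cofree_incl (i + 1) (f0 (i + 1) (cxd Q i x)) =
      d (w i x) - w (i + 1) (cxd Q i x) := esym (wE i x).
  move=> /(canRL (subrK _)) ->.
  by rewrite addrAC [d (w i x) - _]addrC addrK addrC.
have fg i x : counit_fun i (f i x) = gl i x.
  rewrite -[f i x]/(f0 i x - w1 i x) (linearB (counit_fun i)) f0E.
  rewrite -[counit_fun i (w1 i x)]/(cell_pi Y i (cofree_incl i (w1 i x))) w1E.
  by rewrite (wW i x).2 subr0.
exists (@ChainMap N (Prj R) Q cofree f fP); apply: chain_mapP => i.
by apply: linearP_eq => x; apply: fg.
Qed.

Lemma null_homotopic_lift (f : chain_map Q cofree) :
  null_homotopic (chain_comp counit (chain_image (prj_flat_incl R) f)) ->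
  null_homotopic f.
Proof.
move=> [s sE].
(* The homotopy over [Y] is lifted degreewise. Its homotopy sum [h] is a null-homotopic chain map
   with the same image under the counit as [f]. *)
pose s0 i : {linear M i -> cofree_mod (i - N%:Z + 1)} :=
  sval (counit_lift (s i : {linear M i -> cxmod Y (i - N%:Z + 1)})).
have s0E i x : counit_fun (i - N%:Z + 1) (s0 i x) = (s i : {linear M i -> _}) x.
  exact: svalP (counit_lift (s i : {linear M i -> cxmod Y (i - N%:Z + 1)})) x.
pose h i : {linear M i -> cofree_mod i} := @homotopy_sum N (Prj R) Q cofree s0 i.
have hE i x : counit_fun i (h i x) = counit_fun i ((f i : {linear M i -> cofree_mod i}) x).
  pose s0F i : phom (KN_obj (prj_flat_incl R) Q i)
      (KN_obj (prj_flat_incl R) cofree (i - N%:Z + 1)) :=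
    amap (prj_flat_incl R) (s0 i : phom (Q i) (cofree (i - N%:Z + 1))).
  have hsE : counit i \oc homotopy_sum s0F i = homotopy_sum s i.
    rewrite homotopy_sum_compl; congr (homotopy_sum _ i).
    by apply: functional_extensionality_dep => k; apply: linearP_eq => z; apply: s0E.
  have fsE := sE i; rewrite -hsE -homotopy_sum_amap in fsE.
  exact: (esym (congr1 (fun k : {linear M i -> cxmod Y i} => k x) fsE)).
have h_null : null_homotopic (fun i => h i : phom (Q i) (cofree i)) by exists s0.
have hd i x : d (cofree_incl i (h i x)) = cofree_incl (i + 1) (h (i + 1) (cxd Q i x)).
  exact: cofree_homotopy_sum_d.
pose f' i : {linear M i -> cofree_mod i} := f i.
have f'd i x : d (cofree_incl i (f' i x)) = cofree_incl (i + 1) (f' (i + 1) (cxd Q i x)).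
  rewrite -cofree_diffE; congr (cofree_incl _ _).
  exact: esym (congr1 (fun k : {linear M i -> cofree_mod (i + 1)} => k x) (cmapP f i)).
have f'E i : f i = f' i by [].
have {}hE i x : counit_fun i (f' i x) = counit_fun i (h i x) by rewrite hE.
clearbody h f'; clear s sE s0 s0E.
(* The difference of [f] and [h] is a chain map into the kernel [W], hence null-homotopic. *)
pose r i : {linear M i -> E} := lin_comp (cofree_incl i) (f' i - h i).
have rE i x : r i x = cofree_incl i (f' i x) - cofree_incl i (h i x).
  by rewrite -[LHS]/(cofree_incl i ((f' i - h i) x)) lin_subE linearB.
have rW i x : W i (r i x).
  apply: counit_kernel; rewrite lin_subE (linearB (counit_fun i)) hE.
  exact: subrr.
have rd i x : d (r i x) = r (i + 1) (cxd Q i x).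
  by rewrite !rE linearB f'd hd.
have [t [tW tE]] := projective_null_homotopic (@ker_pi_submod _ _ _ Y)
  (cell_ext (ltn0Sn _)) rW rd.
pose t1 i := sval (cofree_factor (tW i)).
have t1E i x : cofree_incl _ (t1 i x) = t i x := svalP (cofree_factor (tW i)) x.
apply: (@eq_null_homotopic N (Prj R) Q cofree
  (fun i => (h i : phom (Q i) (cofree i)) + (f' i - h i : {linear _ -> _}))).
  by move=> i; rewrite f'E addrC; apply: (subrK (h i)).
apply: null_homotopicD h_null _.
exists t1 => i; apply: linearP_eq => x; apply: fssub_incl_inj.
rewrite [RHS]cofree_homotopy_sum -[LHS]/(r i x) tE; apply: eq_bigr => j _.
by rewrite -t1E.
Qed.

End Source.
End Coreflection.

(** * Couniversality of the counit up to homotopy *)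

Theorem lemma4p4 (N : nat) (R : pzRingType) (hN : (2 <= N)%N) :
  exists G : functor (KN N (Flat R)) (KN N (Prj R)),
    left_adjoint_to (j_shriek N R) G.
Proof.
(* Writing N = n + 2 makes the number N - 1 = n + 1 of copies in the suspension positive. *)
case: N hN => [|[|n]] // _; apply: right_adjoint_of_couniversal => Y.
exists (cofree Y), (htpy_class (counit Y)) => Q g.
have [f fE] := chain_map_lift (repr g : chain_map (KN_obj (prj_flat_incl R) Q) Y).
exists (htpy_class f); split.
  rewrite -[LHS]/(htpy_comp _ (KN_map _ _)) KN_mapE htpy_compE fE.
  exact: htpy_reprK.
move=> f' f'E; rewrite -[f']htpy_reprK; apply/htpy_classP.
(* Uniqueness is the lifting of null-homotopies applied to the difference of two factorizations. *)
apply: (@null_homotopic_lift _ _ _ _ (chain_sub f (repr f'))).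
have /htpy_classP : htpy_class (chain_comp (counit Y) (chain_image (prj_flat_incl R) f)) =
    htpy_class (chain_comp (counit Y) (chain_image (prj_flat_incl R) (repr f'))).
  rewrite fE [LHS]htpy_reprK -htpy_compE -KN_mapE htpy_reprK.
  exact: esym f'E.
apply: eq_null_homotopic => i.
rewrite -[RHS]/(counit Y i \oc amap (prj_flat_incl R) (f i - repr f' i)).
by rewrite amapB pcompDr pcompNr.
Qed.
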